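(* There exists a constant $C > 0$ such that for every integer $n \ge 2$, every $n$-dimensional ball $K$ admits a $256$-round subquotient of dimension at least $Cn/(\log n)$.
   Context: Let $V$ be a finite-dimensional real vector space. A ball (also called a symmetric convex body or Banach ball) in $V$ is a compact convex set $K \subset V$ with nonempty interior that is invariant under $x \mapsto -x$; its dimension is $\dim V$. It is the unit ball of a unique norm $\|\cdot\|_K$ on $V$, given by $\|v\|_K = \min\{t \ge 0 : v \in tK\}$. A ball $K$ is an ellipsoid if $\|\cdot\|_K$ is an inner-product norm (so ellipsoids are centered at the origin). A ball $K$ is $r$-round if it contains an ellipsoid $E \subset V$ (of the same dimension) such that $K \subseteq rE$. If $K$ is a ball in $V$ and $W \subseteq V$ is a linear subspace, then $W \cap K$ (a ball in $W$) is called a slice of $K$, and the image of $K$ in $V/W$ (a ball in $V/W$) is called a projection of $K$. A subquotient of $K$ is a slice of a projection of $K$. The symbol $\log$ denotes the natural logarithm (the choice of base only affects the constant $C$). *)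

(* Defs.v *)
From HB Require Import structures.
From mathcomp Require Import all_boot all_order all_algebra.
From mathcomp Require Import generic_quotient ring_quotient sesquilinear.
From mathcomp Require Import all_classical all_reals all_analysis.

Set Implicit Arguments.
Unset Strict Implicit.
Unset Printing Implicit Defensive.

Import Order.TTheory GRing.Theory Num.Theory.
Import numFieldNormedType.Exports.
Import VectorInternalTheory.

Local Open Scope classical_set_scope.
Local Open Scope quotient_scope.
Local Open Scope ring_scope.

(* The library builds the additive group V / W of cosets; the scalar action
   and the finite-dimensional structure are added here. *)
Section QuotientSpace.
Context {F : fieldType} {V : vectType F}.
Variable W : {vspace V}.

Definition quotv : Type := Quotient.quot (pred_of_vspace W).

HB.instance Definition _ := GRing.Zmodule.on quotv.

Definition quotv_pi (v : V) : quotv := \pi_(Quotient.quot (pred_of_vspace W)) v.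
Definition quotv_repr (x : quotv) : V := repr (x : Quotient.quot (pred_of_vspace W)).

Lemma quotv_reprK : cancel quotv_repr quotv_pi.
Proof. by move=> x; apply: reprK. Qed.

Lemma quotv_pi_eq u v : (quotv_pi u == quotv_pi v) = (u - v \in W).
Proof. exact/esym/Quotient.idealrBE. Qed.

Lemma quotv_piD : {morph quotv_pi : u v / u + v}.
Proof. exact: Quotient.pi_add. Qed.

Definition quotv_scale (a : F) (x : quotv) : quotv :=
  quotv_pi (a *: quotv_repr x).

Lemma quotv_piZ a v : quotv_pi (a *: v) = quotv_scale a (quotv_pi v).
Proof.
apply/eqP; rewrite /quotv_scale quotv_pi_eq -scalerBr rpredZ//.
by rewrite -quotv_pi_eq quotv_reprK.
Qed.

Fact quotv_scaleA a b x :
  quotv_scale a (quotv_scale b x) = quotv_scale (a * b) x.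
Proof. by rewrite -[x]quotv_reprK -!quotv_piZ scalerA. Qed.

Fact quotv_scale1 : left_id 1 quotv_scale.
Proof. by move=> x; rewrite -[x]quotv_reprK -quotv_piZ scale1r. Qed.

Fact quotv_scaleDr : right_distributive quotv_scale +%R.
Proof.
move=> a x y; rewrite -[x]quotv_reprK -[y]quotv_reprK.
by rewrite -!quotv_piZ -!quotv_piD -quotv_piZ scalerDr.
Qed.

Fact quotv_scaleDl x : {morph quotv_scale^~ x : a b / a + b}.
Proof.
by move=> a b; rewrite -[x]quotv_reprK -!quotv_piZ -quotv_piD scalerDl.
Qed.

HB.instance Definition _ := GRing.Zmodule_isLmodule.Build F quotv
  quotv_scaleA quotv_scale1 quotv_scaleDr quotv_scaleDl.

Fact quotv_pi_is_linear : linear quotv_pi.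
Proof. by move=> a u v; rewrite quotv_piD quotv_piZ. Qed.

HB.instance Definition _ := GRing.isSemilinear.Build F V quotv _ quotv_pi
  (GRing.semilinear_linear quotv_pi_is_linear).

Lemma quotv_pi_eq0 v : (quotv_pi v == 0) = (v \in W).
Proof. by rewrite -[0](linear0 quotv_pi) quotv_pi_eq subr0. Qed.

Fact quotv_vect_iso : Vector.axiom (\dim W^C) quotv.
Proof.
pose C := subvs_of W^C%VS.
pose g (x : quotv) : C := vsproj W^C (daddv_pi W^C W (quotv_repr x)).
pose f (c : C) : quotv := quotv_pi (vsval c).
have WC : (W^C :&: W = 0)%VS by rewrite capvC capv_compl.
have flin : linear f by move=> a u v; rewrite /f !linearP.
have gK : cancel g f.
  move=> x; rewrite /f /g vsprojK ?memv_pi// -[RHS]quotv_reprK.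
  apply/eqP; rewrite quotv_pi_eq.
  set v := quotv_repr x.
  have vE : daddv_pi W^C W v + daddv_pi W W^C v = v.
    by apply: daddv_pi_add => //; rewrite addvC addv_complf memvf.
  by rewrite -{2}vE opprD addrA subrr sub0r rpredN memv_pi.
have finj : injective f.
  move=> u v /eqP; rewrite quotv_pi_eq -linearB/= => uvW.
  apply/eqP; rewrite -subr_eq0; apply/eqP/val_inj/eqP => /=.
  rewrite -memv0 -WC memv_cap [X in _ && X]uvW andbT.
  by rewrite rpredB ?subvsP.
have fK : cancel f g by move=> c; apply: finj; rewrite gK.
have glin : linear g by move=> a x y; apply: finj; rewrite flin !gK.
exists (fun x => v2r (g x)); first by move=> a x y; rewrite glin linearP.
exists (fun r => f (r2v r)); first by move=> x; rewrite v2rK gK.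
by move=> r; rewrite fK r2vK.
Qed.

HB.instance Definition _ := Lmodule_hasFinDim.Build F quotv quotv_vect_iso.

End QuotientSpace.

Section Balls.
Context {R : realType}.
Implicit Types V : vectType R.

(* V is topologized through the coordinate isomorphism v2r onto row vectors,
   i.e. by its unique Hausdorff vector space topology. *)
Definition is_banach_ball V (K : set V) : Prop :=
  [/\ compact (v2r @` K),
      convex_set (K : set (convex_lmodType V)),
      (v2r @` K)° !=set0 &
      [set - x | x in K] = K].

(* For a ball this infimum is attained. *)
Definition ball_norm V (K : set V) (v : V) : R :=
  inf [set t | 0 <= t /\ [set t *: x | x in K] v].

Definition is_ellipsoid V (E : set V) : Prop :=
  is_banach_ball E /\
  exists f : {dot V for idfun}, forall v, ball_norm E v = Num.sqrt (f v v).

Definition is_round V (r : R) (K : set V) : Prop :=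
  is_banach_ball K /\
  exists E : set V,
    [/\ is_ellipsoid E, E `<=` K & K `<=` [set r *: x | x in E]].

Definition slice V (U : {vspace V}) (K : set V) : set (subvs_of U) :=
  [set u | K (vsval u)].

Definition projection V (W : {vspace V}) (K : set V) : set (quotv W) :=
  quotv_pi W @` K.

Definition subquotient V (W : {vspace V}) (U : {vspace quotv W}) (K : set V) :
    set (subvs_of U) :=
  slice (projection K).

End Balls.

Arguments slice {R V} U K.
Arguments projection {R V} W K.
Arguments subquotient {R V W} U K.

(* Main.v *)
From HB Require Import structures.
Require Import Defs.
From mathcomp Require Import all_boot all_order all_algebra.
From mathcomp Require Import all_classical all_reals all_analysis.
From mathcomp Require Import perm ring lra.

(** Why the theorem holds.  Choose a Euclidean structure in which the norm N
    of K satisfies g|x| <= N(x) <= 2n g|x| ([position]).  From then on only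
    two operations are used: project K along a few random vectors, again and
    again, and finally slice once.

    Let N be any seminorm on R^n with N <= b|.|, and let [ell N m] be the
    average of N over m^(-1/2) times the sum of m independent random sign
    vectors, a discrete substitute for the Gaussian mean of N.  For every k
    there is a dichotomy.

    - If [ell N k] is smaller than b sqrt k / 8, then some k sign vectors span
      a subspace along which the quotient seminorm is at most (b/2)|.|.  This
      is the low M-star estimate [low_mstar].  Its proof compares the averages
      of |<a_j, y>| over random sign vectors a_1, ..., a_k with their mean,
      uniformly over the functionals y dominated by N.  Symmetrization and
      contraction bound the deviation by a multiple of [ell N k], whereas by
      Khintchine's inequality the mean is at least |y|/2; so every dominated y
      orthogonal to all the a_j is short.  By the Hahn-Banach theorem
      ([norming_functional]) such y compute the quotient seminorm.

    - If [ell N k] is at least b sqrt k / 8, then a random sign matrix embeds a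
      Euclidean space of dimension proportional to k on which N is a multiple
      of the Euclidean norm up to a factor 128.  This is Milman's form of
      Dvoretzky's theorem ([dvoretzky]).  Sign vectors are not rotation
      invariant, so the mean values of N in different directions are compared
      by [rad_refine], which splits one sign into many; the fluctuations are
      controlled by [concentration], a consequence of Maurey's property tau for
      the discrete cube; a net of the unit ball finishes the proof.

    Projecting as long as the first case holds, each step costs k dimensions
    and halves b.  The quotient seminorm stays at least g|x| on vectors
    orthogonal to the subspace already divided out, so less than log2(2n) + 1
    steps are possible before the space is exhausted.  With k of order n / log n
    there is room for all of them, hence the second case occurs along the way
    and gives dimension proportional to n / log n
    ([round_section_of_quotient]).  Only the bound b is followed through the
    steps; the averages [ell] may drop as fast as they like.

    The passage from 128 to 256 leaves room between the infimum that defines a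
    quotient seminorm and the projection of K.

    All averages are finite averages over signs, computed by recursion
    ([rademacher]). *)

Import Order.TTheory GRing.Theory Num.Theory.
Import numFieldNormedType.Exports VectorInternalTheory.

Set Implicit Arguments.
Unset Strict Implicit.
Unset Printing Implicit Defensive.

Local Open Scope classical_set_scope.
Local Open Scope ring_scope.

(** * Convex functions and seminorms *)
Section Convex.
Context {R : realType}.
Implicit Types V : lmodType R.

Lemma le_of_eq (x y : R) : x = y -> x <= y.
Proof. by move=> ->. Qed.

(** Stated with a real parameter, so that [lra] applies to it. *)
Definition cvx V (f : V -> R) : Prop :=
  forall (t : R) x y, 0 <= t <= 1 ->
    f ((1 - t) *: x + t *: y) <= (1 - t) * f x + t * f y.

Lemma cvx_shift V (f : V -> R) v : cvx f -> cvx (fun x => f (v + x)).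
Proof.
move=> cf t x y t01; apply: le_trans (cf t _ _ t01).
by rewrite !scalerDr addrACA -scalerDl subrK scale1r.
Qed.

Lemma cvx_mid V (f : V -> R) x v : cvx f -> f x <= (f (v + x) + f (- v + x)) / 2.
Proof.
move=> cf; have h : 0 <= (2^-1 : R) <= 1 by lra.
have := cf _ (v + x) (- v + x) h.
have -> : 1 - 2^-1 = 2^-1 :> R by field.
rewrite -scalerDr addrACA subrr add0r scalerDr -scalerDl.
have -> : 2^-1 + 2^-1 = 1 :> R by field.
by rewrite scale1r -mulrDr mulrC.
Qed.

Definition seminorm V (N : V -> R) : Prop :=
  (forall x y, N (x + y) <= N x + N y) /\ (forall a x, N (a *: x) = `|a| * N x).

Section SeminormTheory.
Variables (V : lmodType R) (N : V -> R).
Hypothesis sN : seminorm N.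

Lemma seminormD x y : N (x + y) <= N x + N y.
Proof. by case: sN. Qed.

Lemma seminormZ a x : N (a *: x) = `|a| * N x.
Proof. by case: sN. Qed.

Lemma seminorm0 : N 0 = 0.
Proof. by rewrite -(scale0r 0) seminormZ normr0 mul0r. Qed.

Lemma seminormN x : N (- x) = N x.
Proof. by rewrite -scaleN1r seminormZ normrN1 mul1r. Qed.

Lemma seminorm_ge0 x : 0 <= N x.
Proof. by have := seminormD x (- x); rewrite subrr seminorm0 seminormN; lra. Qed.

Lemma seminormB x y : N x - N y <= N (x - y).
Proof. by have := seminormD (x - y) y; rewrite subrK; lra. Qed.

Lemma seminorm_sum (I : Type) (r : seq I) (P : pred I) (F : I -> V) :
  N (\sum_(i <- r | P i) F i) <= \sum_(i <- r | P i) N (F i).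
Proof.
elim/big_rec2: _ => [|i y1 y2 _ h]; first by rewrite seminorm0.
by apply: le_trans (seminormD _ _) _; rewrite lerD2l.
Qed.

Lemma seminorm_cvx : cvx N.
Proof.
move=> t x y /andP[t0 t1]; apply: le_trans (seminormD _ _) _.
by rewrite !seminormZ !ger0_norm // subr_ge0.
Qed.

End SeminormTheory.
End Convex.

(** * Rademacher averages *)
Section Rad.
Context {R : realType}.
Implicit Types V : lmodType R.

(** Recursion on [s], instead of a sum over sign vectors, turns symmetrization
    and comparison into inductions that treat one sign at a time. *)
Fixpoint rademacher V (s : seq V) (f : V -> R) : R :=
  if s is v :: s' then
    (rademacher s' (fun x => f (v + x)) + rademacher s' (fun x => f (- v + x))) / 2
  else f 0.

Lemma eq_rad V (s : seq V) f g : f =1 g -> rademacher s f = rademacher s g.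
Proof.
elim: s f g => [|v s IH] f g fg /=; first exact: fg.
by congr ((_ + _) / _); apply: IH => x.
Qed.

Lemma rad_le V (s : seq V) f g : (forall x, f x <= g x) -> rademacher s f <= rademacher s g.
Proof.
elim: s f g => [|v s IH] f g fg /=; first exact: fg.
by rewrite ler_pM2r ?invr_gt0//; apply: lerD; apply: IH.
Qed.

Lemma rad_cst V (s : seq V) c : rademacher s (fun=> c) = c.
Proof. by elim: s => //= v s ->; lra. Qed.

Lemma radD V (s : seq V) f g : rademacher s (fun x => f x + g x) = rademacher s f + rademacher s g.
Proof. by elim: s f g => //= v s IH f g; rewrite !IH; lra. Qed.

Lemma radZ V (s : seq V) c f : rademacher s (fun x => c * f x) = c * rademacher s f.
Proof. by elim: s f => //= v s IH f; rewrite !IH; lra. Qed.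

Lemma rad_sum V (s : seq V) (I : Type) (r : seq I) (P : pred I) (F : I -> V -> R) :
  rademacher s (fun x => \sum_(i <- r | P i) F i x) = \sum_(i <- r | P i) rademacher s (F i).
Proof.
elim: r => [|i r IH].
  by rewrite big_nil -[RHS](rad_cst s); apply: eq_rad => x; rewrite big_nil.
rewrite big_cons -IH; case: ifP => Pi; last by apply: eq_rad => x; rewrite big_cons Pi.
by rewrite -radD; apply: eq_rad => x; rewrite big_cons Pi.
Qed.

Lemma rad_ge0 V (s : seq V) f : (forall x, 0 <= f x) -> 0 <= rademacher s f.
Proof. by move=> f0; rewrite -[0](rad_cst s); apply: rad_le. Qed.

(** The first moment method: every existence statement about random vectors or
    matrices comes from here. *)
Lemma rad_exists V (s : seq V) f : exists x, f x <= rademacher s f.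
Proof.
elim: s f => [|v s IH] f /=; first by exists 0.
have [x hx] := IH (fun x => f (v + x)); have [y hy] := IH (fun x => f (- v + x)).
have [h|h] := leP (rademacher s (fun x => f (v + x))) (rademacher s (fun x => f (- v + x))).
  by exists (v + x); apply: le_trans hx _; lra.
by exists (- v + y); apply: le_trans hy _; lra.
Qed.

Lemma rad_cat V (s t : seq V) f :
  rademacher (s ++ t) f = rademacher s (fun x => rademacher t (fun y => f (x + y))).
Proof.
elim: s f => [|v s IH] f /=; first by apply: eq_rad => x; rewrite add0r.
by congr ((_ + _) / _); rewrite IH; apply: eq_rad => x; apply: eq_rad => y; rewrite addrA.
Qed.

Lemma rad_swap V V' (s : seq V) (t : seq V') F :
  rademacher s (fun x => rademacher t (F x)) = rademacher t (fun y => rademacher s (F ^~ y)).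
Proof.
elim: s F => [|v s IH] F //=; rewrite !IH -radD -[LHS]mulrC -radZ.
by apply: eq_rad => x; rewrite mulrC.
Qed.

Lemma rad_perm V (s t : seq V) f : perm_eq s t -> rademacher s f = rademacher t f.
Proof.
move: s t; apply: (@catCA_perm_subst _ _ (fun s => rademacher s f)) => s1 s2 s3.
rewrite !(rad_cat s1) !(rad_cat s2).
under eq_rad do rewrite rad_cat.
rewrite rad_swap; apply: eq_rad => x; rewrite rad_cat; apply: eq_rad => y.
by apply: eq_rad => z; rewrite addrCA.
Qed.

Lemma rad_map V V' (T : V -> V') (s : seq V) f :
  {morph T : x y / x + y} -> rademacher (map T s) f = rademacher s (fun x => f (T x)).
Proof.
move=> TD; have T0 : T 0 = 0 by apply: (addrI (T 0)); rewrite -TD !addr0.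
have TN x : T (- x) = - T x by apply: (addrI (T x)); rewrite -TD !subrr.
elim: s f => [|v s IH] f /=; first by rewrite T0.
by congr ((_ + _) / _); rewrite IH; apply: eq_rad => x; rewrite TD ?TN.
Qed.

Lemma radN V (s : seq V) f : rademacher s (fun x => f (- x)) = rademacher s f.
Proof.
elim: s f => [|v s IH] f /=; first by rewrite oppr0.
rewrite [in RHS]addrC; congr ((_ + _) / _); rewrite -[RHS]IH;
  by apply: eq_rad => x; rewrite opprD ?opprK.
Qed.

Lemma rad_cvx V V' (s : seq V) (f : V -> V' -> R) :
  (forall x, cvx (f x)) -> cvx (fun y => rademacher s (f ^~ y)).
Proof.
by move=> cf t x y t01; rewrite -!radZ -radD; apply: rad_le => z; apply: cf.
Qed.

Lemma rad_shift_cvx V (s : seq V) (f : V -> R) :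
  cvx f -> cvx (fun x => rademacher s (fun y => f (x + y))).
Proof.
move=> cf; apply: (@rad_cvx V V s (fun y x => f (x + y))) => y t a b t01.
have := cvx_shift y cf a b t01; rewrite ![y + _]addrC; exact.
Qed.

(** Jensen's inequality: independent symmetric noise increases the average of
    a convex function. *)
Lemma le_rad V (s : seq V) f x : cvx f -> f x <= rademacher s (fun y => f (y + x)).
Proof.
elim: s f x => [|v s IH] f x cf /=; first by rewrite add0r.
apply: le_trans (cvx_mid x v cf) _.
rewrite ler_pM2r ?invr_gt0//; apply: lerD.
  apply: le_trans (IH _ x (cvx_shift v cf)) _.
  by apply: rad_le => y /=; rewrite addrA.
apply: le_trans (IH _ x (cvx_shift (- v) cf)) _.
by apply: rad_le => y /=; rewrite addrA.
Qed.

Lemma rad_sub V (s t : seq V) f : cvx f -> rademacher s f <= rademacher (s ++ t) f.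
Proof.
move=> cf; rewrite rad_cat; apply: rad_le => x; apply: le_trans (le_rad t x cf) _.
by apply: rad_le => y; rewrite addrC.
Qed.

End Rad.

(** * Khintchine's inequality and comparison of averages *)
Section Khintchine.
Context {R : realType}.
Implicit Types (V : lmodType R).

Definition sumsq (ts : seq R) : R := \sum_(t <- ts) t ^+ 2.

Lemma sumsq_ge0 ts : 0 <= sumsq ts.
Proof. by apply: sumr_ge0 => t _; apply: sqr_ge0. Qed.

Lemma rad_sqr (ts : seq R^o) (c : R) :
  rademacher ts (fun x : R^o => (x + c) ^+ 2) = c ^+ 2 + sumsq ts.
Proof.
rewrite /sumsq; elim: ts c => [|t ts IH] c /=; first by rewrite big_nil; ring.
rewrite big_cons.
have E (u : R) : rademacher ts (fun x : R^o => ((u : R^o) + x + c) ^+ 2) =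
    (u + c) ^+ 2 + \sum_(t <- ts) t ^+ 2.
  by rewrite -IH; apply: eq_rad => x; congr (_ ^+ 2); rewrite addrCA addrA.
by rewrite !E; field.
Qed.

Lemma rad_quad (ts : seq R^o) (c : R) :
  rademacher ts (fun x : R^o => (x + c) ^+ 4)
    <= c ^+ 4 + 6 * c ^+ 2 * sumsq ts + 3 * sumsq ts ^+ 2.
Proof.
rewrite /sumsq; elim: ts c => [|t ts IH] c /=.
  by rewrite big_nil le_eqVlt; apply/orP; left; apply/eqP; ring.
rewrite big_cons.
set S := \sum_(j <- ts) _ in IH *.
have E (u : R) : rademacher ts (fun x : R^o => ((u : R^o) + x + c) ^+ 4) <=
    (u + c) ^+ 4 + 6 * (u + c) ^+ 2 * S + 3 * S ^+ 2.
  apply: le_trans (IH (u + c)); apply: rad_le => x.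
  by apply: le_of_eq; congr (_ ^+ 4); rewrite addrCA addrA.
have h1 := E t; have h2 := E (- t).
set a := rademacher _ _ in h1 *; set b := rademacher _ _ in h2 *.
have h3 : 0 <= t ^+ 4 by rewrite exprn_even_ge0.
rewrite ler_pdivrMr//; apply: le_trans (lerD h1 h2) _.
rewrite -subr_ge0; set x := (X in 0 <= X).
have -> : x = 4 * t ^+ 4 by rewrite /x; ring.
by rewrite mulr_ge0.
Qed.

(** Let r^2 be the sum of the squares.  The second moment is r^2 and the fourth
    at most 3 r^4, so the average of the minorant (9 r^2 x^2 - x^4) / (12 r^3)
    of |x| is at least r / 2. *)
Lemma khintchine (ts : seq R^o) :
  Num.sqrt (sumsq ts) / 2 <= rademacher ts (fun x : R^o => `|x : R|).
Proof.
have S0 := sumsq_ge0 ts.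
set r := Num.sqrt _.
have r0 : 0 <= r by apply: sqrtr_ge0.
have rE : r ^+ 2 = sumsq ts by rewrite sqr_sqrtr.
have [rz|rn0] := eqVneq r 0.
  by rewrite rz mul0r; apply: rad_ge0 => x.
have rp : 0 < r by rewrite lt_neqAle eq_sym rn0.
have E4 (z : R) : z ^+ 4 = (z ^+ 2) ^+ 2 by ring.
have pt (x : R^o) : `|x : R| >= (9 * r ^+ 2 * x ^+ 2 - x ^+ 4) / (12 * r ^+ 3).
  rewrite ler_pdivrMr ?mulr_gt0 ?exprn_gt0//.
  have -> : x ^+ 2 = `|x : R| ^+ 2 by rewrite real_normK ?num_real.
  have -> : x ^+ 4 = `|x : R| ^+ 4 by rewrite !E4 real_normK ?num_real.
  set y := `|x : R|; have y0 : 0 <= y by exact: normr_ge0.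
  have : 0 <= y * (12 * r ^+ 3 - 9 * r ^+ 2 * y + y ^+ 3).
    apply: mulr_ge0 => //.
    (* The cubic is smallest at y = sqrt 3 r; 7 / 4 approximates sqrt 3. *)
    have -> : 12 * r ^+ 3 - 9 * r ^+ 2 * y + y ^+ 3 =
      (y - 7 / 4 * r) ^+ 2 * (y + 7 / 2 * r) + (3 / 16) * r ^+ 2 * y + (41 / 32) * r ^+ 3 by field.
    by rewrite !addr_ge0// mulr_ge0 ?sqr_ge0 ?addr_ge0 ?mulr_ge0 ?exprn_ge0//; lra.
  by move=> h; rewrite -subr_ge0; apply: le_trans h _; apply: le_of_eq; ring.
apply: le_trans (rad_le _ pt).
have -> : rademacher ts (fun x : R^o => (9 * r ^+ 2 * x ^+ 2 - x ^+ 4) / (12 * r ^+ 3)) =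
   (12 * r ^+ 3)^-1 * (9 * r ^+ 2 * rademacher ts (fun x : R^o => x ^+ 2)
      - rademacher ts (fun x : R^o => x ^+ 4)).
  rewrite -mulN1r -!radZ -radD -radZ; apply: eq_rad => x; by rewrite mulN1r mulrC.
have := rad_sqr ts 0; have := rad_quad ts 0.
have e2 : (fun x : R^o => (x + 0) ^+ 2) =1 (fun x : R^o => x ^+ 2) by move=> x; rewrite addr0.
have e4 : (fun x : R^o => (x + 0) ^+ 4) =1 (fun x : R^o => x ^+ 4) by move=> x; rewrite addr0.
rewrite (eq_rad _ e2) (eq_rad _ e4) -rE => h4 ->.
set q := rademacher _ _ in h4 *.
have h : q <= 3 * r ^+ 4 by apply: le_trans h4 _; apply: le_of_eq; ring.
rewrite [leRHS]mulrC ler_pdivlMr ?mulr_gt0 ?exprn_gt0//.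
rewrite -subr_ge0 in h; rewrite -subr_ge0; apply: le_trans h _.
by apply: le_of_eq; field.
Qed.

Lemma rad_jensen V (s : seq V) (phi : V -> R) (g : R^o -> R) :
  cvx g -> g (rademacher s phi) <= rademacher s (fun x => g (phi x)).
Proof.
move=> cg; elim: s phi => //= v s IH phi.
have h := IH (fun x => phi (v + x)); have h' := IH (fun x => phi (- v + x)).
set a := rademacher s _ in h *; set b := rademacher s _ in h' *.
have half : 0 <= (2^-1 : R) <= 1 by lra.
have := cg _ a b half.
have -> : (1 - 2^-1) *: (a : R^o) + 2^-1 *: (b : R^o) = (a + b) / 2 by rewrite /GRing.scale/=; field.
move=> h2; apply: le_trans h2 _; lra.
Qed.

Lemma cvx_even_le (g : R^o -> R) (k m : R) :
  cvx g -> (forall x, g (- x) = g x) -> `|k| <= m -> g k <= g m.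
Proof.
move=> cg ge km; have m0 : 0 <= m by apply: le_trans km.
have [mz|mn0] := eqVneq m 0.
  by move: km; rewrite mz normr_le0 => /eqP ->.
have mp : 0 < m by rewrite lt_neqAle eq_sym mn0.
(* k is the mixture of m and - m with weight t on - m. *)
pose t := (1 - k / m) / 2.
have t01 : 0 <= t <= 1.
  move: km; rewrite ler_norml => /andP[h1 h2].
  have : - 1 <= k / m by rewrite ler_pdivlMr// mulN1r.
  have : k / m <= 1 by rewrite ler_pdivrMr// mul1r.
  rewrite /t; lra.
have := cg t m (- m) t01; rewrite ge.
have -> : (1 - t) *: (m : R^o) + t *: (- m : R^o) = k by rewrite /GRing.scale/= /t; field.
by rewrite -mulrDl subrK mul1r.
Qed.

(** A combination x of signs is symmetric, so f (x *: e) may be averaged with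
    f (- x *: e); the result is even and convex in x, hence by Jensen at least
    its value at the mean of |x|, to which Khintchine's inequality applies. *)
Lemma rad_line V (e : V) (ts : seq R^o) (f : V -> R) (k : R) :
  cvx f -> 2 * `|k| <= Num.sqrt (sumsq ts) ->
  (f (k *: e) + f (- (k *: e))) / 2 <= rademacher ts (fun x : R^o => f (x *: e)).
Proof.
move=> cf hk.
pose g (x : R^o) : R := (f (x *: e) + f (- (x *: e))) / 2.
have cg : cvx g.
  move=> t x y t01; rewrite /g.
  have := cf t (x *: e) (y *: e) t01; have := cf t (- (x *: e)) (- (y *: e)) t01.
  rewrite !scalerN -opprD !scalerA -scalerDl; move: (f _) (f _) => u w; lra.
have ge x : g (- x) = g x by rewrite /g scaleNr opprK addrC.
have -> : rademacher ts (fun x : R^o => f (x *: e)) = rademacher ts g.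
  rewrite /g; under [RHS]eq_rad do rewrite mulrDl mulrC.
  rewrite radD radZ; under [X in _ + X]eq_rad do rewrite mulrC -scaleNr.
  rewrite radZ (radN ts (fun x : R^o => f (x *: e))); lra.
have -> : rademacher ts g = rademacher ts (fun x => g `|x : R|).
  by apply: eq_rad => x; case: (ger0P (x : R)) => // _; rewrite ge.
apply: le_trans (rad_jensen ts (fun x : R^o => `|x : R|) cg).
apply: (cvx_even_le cg ge); apply: le_trans (khintchine ts); lra.
Qed.

(** For the standard basis [es], the average over [fam cs es] is the average
    over the sums of c_j a_j, where the a_j are independent random sign
    vectors. *)
Definition fam V (cs : seq R) (es : seq V) : seq V := [seq c *: e | c <- cs, e <- es].

Lemma fam_cons V c cs (es : seq V) : fam (c :: cs) es = map ( *:%R c) es ++ fam cs es.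
Proof. by []. Qed.

Lemma fam_cat V cs ds (es : seq V) : fam (cs ++ ds) es = fam cs es ++ fam ds es.
Proof. exact: allpairs_cat. Qed.

Lemma fam_map V a cs (es : seq V) : fam (map ( *%R a) cs) es = map ( *:%R a) (fam cs es).
Proof.
elim: cs => //= c cs IH; rewrite !fam_cons IH map_cat -map_comp; congr (_ ++ _).
by apply: eq_map => x /=; rewrite scalerA.
Qed.

Lemma rad_scale V (e : V) (ts : seq R) f :
  rademacher [seq t *: e | t <- ts] f = rademacher (ts : seq R^o) (fun x : R^o => f (x *: e)).
Proof.
elim: ts f => [|t ts IH] f /=; first by rewrite scale0r.
by congr ((_ + _) / _); rewrite IH; apply: eq_rad => x; rewrite scalerDl ?scaleNr.
Qed.

Lemma rad_group V (es : seq V) (ts : seq R) k (f : V -> R) :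
  cvx f -> 2 * `|k| <= Num.sqrt (sumsq ts) ->
  rademacher (map ( *:%R k) es) f <= rademacher (fam ts es) f.
Proof.
move=> cf hk; elim: es f cf => [|e es IH] f cf.
  by rewrite /fam /=; elim: ts {hk} => //= t ts ->.
have P : perm_eq (fam ts (e :: es)) ([seq t *: e | t <- ts] ++ fam ts es).
  exact/permPl/(perm_allpairs_consr (fun c (x : V) => c *: x) ts (fun=> e) (fun=> es)).
rewrite (rad_perm _ P) rad_cat rad_scale.
pose h x := rademacher (map ( *:%R k) es) (fun y => f (x + y)).
have ch : cvx h by apply: rad_shift_cvx.
have -> : rademacher (map ( *:%R k) (e :: es)) f = (h (k *: e) + h (- (k *: e))) / 2 by [].
apply: le_trans (rad_line e ch hk) _.
by apply: rad_le => x; apply: IH; apply: cvx_shift.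
Qed.

(** Replacing a sign with coefficient k by several signs whose coefficients have
    total square at least (2k)^2 cannot decrease the average.  This monotonicity
    under refinement takes the place of rotation invariance. *)
Lemma rad_refine V (es : seq V) (ks : seq R) (tss : seq (seq R)) (f : V -> R) :
  cvx f -> all2 (fun k ts => 2 * `|k| <= Num.sqrt (sumsq ts)) ks tss ->
  rademacher (fam ks es) f <= rademacher (fam (flatten tss) es) f.
Proof.
elim: ks tss f => [|k ks IH] [|ts tss] f cf //= /andP[hk hks].
rewrite fam_cons fam_cat !rad_cat.
apply: (@le_trans _ _ (rademacher (fam ts es) (fun x => rademacher (fam ks es) (fun y => f (x + y))))).
  by apply: rad_group hk; apply: rad_shift_cvx.
by apply: rad_le => x; apply: IH hks; apply: cvx_shift.
Qed.

End Khintchine.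

(** * Concentration on the discrete cube *)
Section Concentration.
Context {R : realType}.
Implicit Types (V : lmodType R) (y z e : nat -> R).

Definition scons (a : R) y : nat -> R := fun i => if i is j.+1 then y j else a.

(** Here the signs themselves are the argument of [F], because the points [Y e]
    in [property_tau] depend on them.  Sequences are functions on [nat], so that
    the induction on [m] stays within one type. *)
Fixpoint signavg (m : nat) (F : (nat -> R) -> R) : R :=
  if m is m'.+1 then
    (signavg m' (fun e => F (scons 1 e)) + signavg m' (fun e => F (scons (- 1) e))) / 2
  else F (fun=> 0).

Lemma signavg_le m F G : (forall e, F e <= G e) -> signavg m F <= signavg m G.
Proof.
elim: m F G => [|m IH] F G FG /=; first exact: FG.
by rewrite ler_pM2r ?invr_gt0//; apply: lerD; apply: IH.
Qed.

Lemma signavg_gt0 m F : (forall e, 0 < F e) -> 0 < signavg m F.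
Proof.
elim: m F => [|m IH] F F0 /=; first exact: F0.
by rewrite divr_gt0// addr_gt0//; apply: IH.
Qed.

Lemma signavgD m F G : signavg m (fun e => F e + G e) = signavg m F + signavg m G.
Proof. by elim: m F G => //= m IH F G; rewrite !IH; lra. Qed.

Lemma signavgZ m c F : signavg m (fun e => c * F e) = c * signavg m F.
Proof. by elim: m F => //= m IH F; rewrite !IH; lra. Qed.

Lemma rademacher_signavg V (s : seq V) f :
  rademacher s f =
  signavg (size s) (fun e => f (\sum_(i < size s) e i *: nth 0 s i)).
Proof.
elim: s f => [|v s IH] f /=; first by rewrite big_ord0.
rewrite !IH.
have E a : signavg (size s) (fun e => f (a *: v + \sum_(i < size s) e i *: nth 0 s i)) =
  signavg (size s) (fun e => f (\sum_(i < (size s).+1) scons a e i *: nth 0 (v :: s) i)).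
  by congr signavg; apply: funext => e; rewrite big_ord_recl.
by rewrite -!E scaleN1r scale1r.
Qed.

Definition mix (t : R) y z : nat -> R := fun i => (1 - t) * y i + t * z i.

Lemma mix_scons t a b y z :
  mix t (scons a y) (scons b z) = scons ((1 - t) * a + t * b) (mix t y z).
Proof. by apply: funext => -[|i]. Qed.

Definition mixcvx (F : (nat -> R) -> R) : Prop :=
  forall t y z, 0 <= t <= 1 -> F (mix t y z) <= (1 - t) * F y + t * F z.

Lemma mixcvx_scons a F : mixcvx F -> mixcvx (fun y => F (scons a y)).
Proof.
move=> cF t y z t01; have := cF _ (scons a y) (scons a z) t01.
by rewrite mix_scons -mulrDl subrK mul1r.
Qed.

Lemma expR_le_inv (x : R) : x < 1 -> expR x <= (1 - x)^-1.
Proof.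
move=> x1; rewrite -[x in expR x]opprK expRN lef_pV2 ?posrE ?expR_gt0//.
  by have := expR_ge1Dx (- x).
by rewrite subr_gt0.
Qed.

(** The one-dimensional case of property tau for a convex function with values
    a at 1 and c at -1: the point 1 - 2s of the segment, at squared distance
    4 s^2 from 1, serves the sign 1, while the sign -1 stays in place. *)
Lemma two_point_ordered (a c : R) : c <= a ->
  exists2 s : R, 0 <= s <= 1 &
  (expR (- a) + expR (- c)) *
  (expR ((1 - s) * a + s * c + s ^+ 2 / 16) + expR c) <= 4.
Proof.
move=> ca; pose D := a - c; have aE : a = c + D by rewrite /D; ring.
have D0 : 0 <= D by rewrite subr_ge0.
have fE : expR (- a) + expR (- c) = expR (- c) * (1 + expR (- D)).
  by rewrite mulrDr mulr1 -expRD aE opprD addrC.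
have e0 : expR (- c) * expR c = 1 by rewrite -expRD addNr expR0.
have facE p q : expR (- c) * p * (expR c * q + expR c) = p * (q + 1).
  transitivity (expR (- c) * expR c * (p * (q + 1))); first by ring.
  by rewrite e0 mul1r.
have eD : expR (- D) <= (1 + D)^-1 by have := @expR_le_inv (- D); rewrite opprK; apply; lra.
have [D8|D8] := leP D (1 / 8).
  (* s = 8 D minimizes the exponent a - s D + s^2 / 16. *)
  exists (8 * D); first by lra.
  have -> : (1 - 8 * D) * a + 8 * D * c + (8 * D) ^+ 2 / 16 = c + (D - 4 * D ^+ 2).
    by rewrite aE; field.
  rewrite fE expRD facE.
  rewrite mulrDl mul1r mulrDr mulr1 -[X in _ + (X + _) <= _]expRD.
  have -> : - D + (D - 4 * D ^+ 2) = - (4 * D ^+ 2) by ring.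
  have h1 : expR (- (4 * D ^+ 2)) <= 1.
    by rewrite -expR0 ler_expR oppr_le0 mulr_ge0 ?sqr_ge0.
  have D2 : 0 <= D ^+ 2 <= 1 / 8 * D by rewrite sqr_ge0 expr2 ler_wpM2r.
  have h2 : expR (D - 4 * D ^+ 2) <= 1 + D - 2 * D ^+ 2.
    apply: le_trans (@expR_le_inv _ _) _; first by lra.
    rewrite -div1r ler_pdivrMr; last by lra.
    have -> : (1 + D - 2 * D ^+ 2) * (1 - (D - 4 * D ^+ 2)) =
      1 + D ^+ 2 * (1 - 2 * D ^+ 2 * 4 + 6 * D) by ring.
    rewrite lerDl mulr_ge0//; lra.
  have h3 : expR (- D) <= 1 - D + D ^+ 2.
    apply: le_trans eD _; rewrite -div1r ler_pdivrMr; last by lra.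
    have -> : (1 - D + D ^+ 2) * (1 + D) = 1 + D ^+ 2 * D by ring.
    by rewrite lerDl mulr_ge0//; lra.
  lra.
(* Far apart values: move all the way to the point -1. *)
exists 1; first by lra.
have -> : (1 - 1) * a + 1 * c + 1 ^+ 2 / 16 = c + 1 / 16 :> R by field.
rewrite fE expRD facE.
have h1 : expR (1 / 16) <= 16 / 15 :> R.
  have -> : 16 / 15 = (1 - 1 / 16)^-1 :> R by field.
  by apply: expR_le_inv; lra.
have h2 : expR (- D) <= 8 / 9.
  apply: le_trans eD _; rewrite -div1r ler_pdivrMr; lra.
apply: (@le_trans _ _ ((1 + 8 / 9) * (16 / 15 + 1))); last by lra.
by apply: ler_pM; rewrite ?addr_ge0 ?expR_ge0//; lra.
Qed.

Lemma two_point (a c : R) :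
  exists s s' : R, [/\ 0 <= s <= 1, 0 <= s' <= 1 &
  (expR (- a) + expR (- c)) *
  (expR ((1 - s) * a + s * c + s ^+ 2 / 16) +
   expR ((1 - s') * a + s' * c + (1 - s') ^+ 2 / 16)) <= 4].
Proof.
have [ca|/ltW ac] := leP c a.
  have [s s01 hs] := two_point_ordered ca; exists s, 1; split => //; first by lra.
  by have -> : (1 - 1) * a + 1 * c + (1 - 1) ^+ 2 / 16 = c by field.
have [s s01 hs] := two_point_ordered ac; exists 0, (1 - s); split => //; try lra.
have -> : (1 - 0) * a + 0 * c + 0 ^+ 2 / 16 = a by field.
rewrite [X in X * _]addrC [X in _ * X]addrC.
by have -> : (1 - (1 - s)) * a + (1 - s) * c + (1 - (1 - s)) ^+ 2 / 16 =
  (1 - s) * c + s * a + s ^+ 2 / 16 by ring.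
Qed.

Lemma expR_mix (t x y : R) : 0 <= t <= 1 ->
  expR ((1 - t) * x + t * y) <= (1 - t) * expR x + t * expR y.
Proof.
move=> t01; set m := (1 - t) * x + t * y.
have h u : expR m * (1 + (u - m)) <= expR u.
  have -> : expR u = expR m * expR (u - m) by rewrite -expRD addrC subrK.
  rewrite ler_pM2l ?expR_gt0//.
  exact: expR_ge1Dx.
have hx := h x; have hy := h y.
have -> : expR m = (1 - t) * (expR m * (1 + (x - m))) + t * (expR m * (1 + (y - m))).
  by rewrite {3 5}/m; ring.
by apply: lerD; apply: ler_wpM2l => //; lra.
Qed.

Definition cost m e y : R := \sum_(i < m) (e i - y i) ^+ 2.

Lemma cost_mix m e y z t : 0 <= t <= 1 ->
  cost m e (mix t y z) <= (1 - t) * cost m e y + t * cost m e z.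
Proof.
move=> /andP[t0 t1]; rewrite /cost !mulr_sumr -big_split; apply: ler_sum => i _ /=.
rewrite /mix -subr_ge0.
have -> : (1 - t) * (e i - y i) ^+ 2 + t * (e i - z i) ^+ 2
  - (e i - ((1 - t) * y i + t * z i)) ^+ 2 = t * (1 - t) * (y i - z i) ^+ 2 by ring.
by apply: mulr_ge0; [apply: mulr_ge0; lra | exact: sqr_ge0].
Qed.

Lemma cost_scons m a b e y :
  cost m.+1 (scons a e) (scons b y) = (a - b) ^+ 2 + cost m e y.
Proof. by rewrite /cost big_ord_recl. Qed.

Lemma mix_arith (t a c q f1 f2 c1 c2 : R) :
  q / 64 + ((1 - t) * f1 + t * f2 + ((1 - t) * c1 + t * c2) * 64^-1) =
  (1 - t) * a + t * c + q / 64 + ((1 - t) * (f1 + c1 / 64 - a) + t * (f2 + c2 / 64 - c)).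
Proof. by ring. Qed.

(** Maurey's property tau for the discrete cube and convex functions.  In the
    induction step, each of the two faces of the cube given by the first sign
    provides its own choice of points.  A vertex with first sign 1 is served by
    a mixture, with weight s on the opposite face: by convexity of [F], of
    the cost and of the exponential, the bounds for the two faces are mixed with
    the same weights, at the price 4 s^2 / 64, and [two_point] chooses s. *)
Lemma property_tau m F : mixcvx F ->
  exists Y : (nat -> R) -> (nat -> R),
    signavg m (fun e => expR (- F e)) *
    signavg m (fun e => expR (F (Y e) + cost m e (Y e) / 64)) <= 1.
Proof.
elim: m F => [|m IH] F cF.
  exists id; rewrite /= /cost big_ord0 mul0r addr0 -expRD addNr expR0; exact: lexx.
pose Fp y := F (scons 1 y); pose Fm y := F (scons (- 1) y).
have c64 : 0 <= 64^-1 :> R by rewrite invr_ge0.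
have [Yp hp] := IH _ (mixcvx_scons 1 cF).
have [Ym hm] := IH _ (mixcvx_scons (- 1) cF).
rewrite -/Fp in hp; rewrite -/Fm in hm.
set gp := fun e => Fp (Yp e) + cost m e (Yp e) / 64.
set gm := fun e => Fm (Ym e) + cost m e (Ym e) / 64.
have Pp : 0 < signavg m (fun e => expR (- Fp e)) by apply: signavg_gt0 => e; apply: expR_gt0.
have Pm : 0 < signavg m (fun e => expR (- Fm e)) by apply: signavg_gt0 => e; apply: expR_gt0.
pose a := - ln (signavg m (fun e => expR (- Fp e))).
pose c := - ln (signavg m (fun e => expR (- Fm e))).
have aE : signavg m (fun e => expR (- Fp e)) = expR (- a) by rewrite /a opprK lnK.
have cE : signavg m (fun e => expR (- Fm e)) = expR (- c) by rewrite /c opprK lnK.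
have Gp : signavg m (fun e => expR (gp e - a)) <= 1.
  apply: le_trans hp; rewrite aE -signavgZ; apply: signavg_le => e.
  by rewrite -expRD addrC.
have Gm : signavg m (fun e => expR (gm e - c)) <= 1.
  apply: le_trans hm; rewrite cE -signavgZ; apply: signavg_le => e.
  by rewrite -expRD addrC.
have [s [s' [s01 s'01 hs]]] := two_point a c.
pose tl e : nat -> R := fun i => e i.+1.
pose Y e := if e 0%N == 1 then mix s (scons 1 (Yp (tl e))) (scons (- 1) (Ym (tl e)))
            else mix s' (scons 1 (Yp (tl e))) (scons (- 1) (Ym (tl e))).
exists Y.
have key (t b : R) : 0 <= t <= 1 ->
  signavg m (fun e => expR (F (mix t (scons 1 (Yp e)) (scons (- 1) (Ym e))) +
     cost m.+1 (scons b e) (mix t (scons 1 (Yp e)) (scons (- 1) (Ym e))) / 64))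
  <= expR ((1 - t) * a + t * c + (b - (1 - 2 * t)) ^+ 2 / 64).
  move=> t01; set k := (b - (1 - 2 * t)) ^+ 2 / 64.
  apply: (@le_trans _ _ (expR ((1 - t) * a + t * c + k) *
     signavg m (fun e => (1 - t) * expR (gp e - a) + t * expR (gm e - c)))).
    rewrite -signavgZ; apply: signavg_le => e.
    apply: le_trans
      (_ : expR ((1 - t) * a + t * c + k + ((1 - t) * (gp e - a) + t * (gm e - c))) <= _);
      last first.
      by rewrite [leLHS]expRD ler_pM2l ?expR_gt0// expR_mix.
    rewrite ler_expR.
    have h1 := cF t (scons 1 (Yp e)) (scons (- 1) (Ym e)) t01.
    have h2 := cost_mix m e (Yp e) (Ym e) t01.
    set q := (b - (1 - 2 * t)) ^+ 2 in k *.
    rewrite mix_scons cost_scons -mix_scons /k /gp /gm /Fp /Fm.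
    have -> : (1 - t) * 1 + t * - 1 = 1 - 2 * t by ring.
    rewrite -/q.
    have h3 := lerD h1 (ler_wpM2r c64 h2).
    rewrite -(mix_arith t a c q) mulrDl addrCA lerD2l; exact: h3.
  rewrite -[leRHS]mulr1; apply: ler_wpM2l; first exact: expR_ge0.
  rewrite signavgD !signavgZ.
  case/andP: t01 => t0 t1; have t1' : 0 <= 1 - t by rewrite subr_ge0.
  by have := lerD (ler_wpM2l t1' Gp) (ler_wpM2l t0 Gm); rewrite !mulr1 subrK.
rewrite /=.
have Y1 e : Y (scons 1 e) = mix s (scons 1 (Yp e)) (scons (- 1) (Ym e)).
  by rewrite /Y /= eqxx.
have Y2 e : Y (scons (- 1) e) = mix s' (scons 1 (Yp e)) (scons (- 1) (Ym e)).
  by rewrite /Y /= eq_sym -subr_eq0 opprK -mulr2n pnatr_eq0.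
under [X in _ * ((signavg m X + _) / 2)]funext do rewrite Y1.
under [X in _ * ((_ + signavg m X) / 2)]funext do rewrite Y2.
have k1 := key s 1 s01; have k2 := key s' (- 1) s'01.
rewrite -/Fp -/Fm aE cE.
have E1 : (1 - (1 - 2 * s)) ^+ 2 / 64 = s ^+ 2 / 16 by field.
have E2 : (- 1 - (1 - 2 * s')) ^+ 2 / 64 = (1 - s') ^+ 2 / 16 by field.
rewrite E1 in k1; rewrite E2 in k2.
have := lerD k1 k2; set X := signavg _ _ + signavg _ _ => hX.
have P0 : 0 <= expR (- a) + expR (- c) by rewrite addr_ge0// expR_ge0.
rewrite mulrACA -invfM ler_pdivrMr ?mul1r ?mulr_gt0//.
apply: le_trans (le_trans (ler_wpM2l P0 hX) hs) _.
by rewrite -natrM.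
Qed.

Lemma quad_arith (r u v q : R) :
  u - v <= q * r -> - (16 * q ^+ 2) + u <= v + r ^+ 2 / 64.
Proof. by have := sqr_ge0 (r / 8 - 4 * q); nra. Qed.

(** Property tau for the function l N: moving by a distance r changes l N by at
    most l b r, and l b r - r^2 / 64 never exceeds 16 (l b)^2. *)
Lemma concentration V (s : seq V) (N : V -> R) (b l : R) :
  seminorm N -> 0 <= l -> 0 <= b ->
  (forall c : nat -> R, N (\sum_(i < size s) c i *: nth 0 s i) <=
     b * Num.sqrt (\sum_(i < size s) c i ^+ 2)) ->
  rademacher s (fun x => expR (l * N x)) * rademacher s (fun x => expR (- (l * N x)))
  <= expR (16 * (l * b) ^+ 2).
Proof.
move=> sN l0 b0 Lip; rewrite !rademacher_signavg.
pose L (e : nat -> R) := \sum_(i < size s) e i *: nth 0 s i.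
pose F e := l * N (L e).
have cF : mixcvx F.
  move=> t y z t01; rewrite /F.
  have -> : L (mix t y z) = (1 - t) *: L y + t *: L z.
    rewrite /L !scaler_sumr -big_split; apply: eq_bigr => i _ /=.
    by rewrite !scalerA -scalerDl.
  have := seminorm_cvx sN (L y) (L z) t01; move: (N _) (N _) (N _) => u v w h.
  by rewrite ![_ * (l * _)]mulrCA -mulrDr ler_wpM2l.
have [Y hY] := property_tau (size s) cF.
have E16 : 0 < expR (- (16 * (l * b) ^+ 2)) :> R by apply: expR_gt0.
rewrite -(ler_pM2l E16) -expRD addNr expR0 mulrA mulrC; apply: le_trans hY.
apply: ler_wpM2l; first by apply/ltW/signavg_gt0 => e; apply: expR_gt0.
rewrite -signavgZ; apply: signavg_le => e; rewrite -expRD ler_expR -/(L e) /F.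
set C := cost _ _ _.
have C0 : 0 <= C by apply: sumr_ge0 => i _; apply: sqr_ge0.
have h : N (L e) - N (L (Y e)) <= b * Num.sqrt C.
  apply: le_trans (seminormB sN _ _) _.
  have -> : L e - L (Y e) = \sum_(i < size s) (e i - Y e i) *: nth 0 s i.
    by rewrite /L -sumrB; apply: eq_bigr => i _; rewrite scalerBl.
  exact: (Lip (fun i => e i - Y e i)).
have : l * N (L e) - l * N (L (Y e)) <= l * b * Num.sqrt C.
  by rewrite -mulrBr -mulrA ler_wpM2l.
by move=> /quad_arith; rewrite sqr_sqrtr.
Qed.

End Concentration.

(** * Sublinear functions and norming functionals *)
Section Sublinear.
Context {R : realType}.
Implicit Types V : lmodType R.

Definition sublinear V (p : V -> R) : Prop :=
  (forall x y, p (x + y) <= p x + p y) /\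
  (forall c x, 0 <= c -> p (c *: x) <= c * p x).

Lemma sublinear0 V (p : V -> R) : sublinear p -> p 0 = 0.
Proof.
move=> [pD pZ]; have := pZ 0 0 (lexx _); have := pD 0 0.
by rewrite scaler0 mul0r addr0; lra.
Qed.

Lemma sublinearN V (p : V -> R) x : sublinear p -> - p (- x) <= p x.
Proof. by move=> sp; have := sp.1 x (- x); rewrite subrr sublinear0//; lra. Qed.

(** The step of the Hahn-Banach theorem: the new function is the infimum over
    t >= 0 of p (x + t v) - t p v. *)
Lemma sublinear_flatten V (p : V -> R) (v : V) : sublinear p ->
  exists q : V -> R, [/\ sublinear q, (forall x, q x <= p x) & q (- v) <= - p v].
Proof.
move=> sp; have [pD pZ] := sp.
pose A x : set R := [set p (x + t *: v) - t * p v | t in [set t | 0 <= t]].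
pose q x := inf (A x).
have lb x t : 0 <= t -> - p (- x) <= p (x + t *: v) - t * p v.
  move=> t0; have := pD (x + t *: v) (- x); rewrite [x + _]addrC addrK.
  have : p v * t <= p (t *: v).
    have [->|tn0] := eqVneq t 0; first by rewrite mulr0 scale0r sublinear0.
    have tp : 0 < t by rewrite lt_neqAle eq_sym tn0.
    have := pZ t^-1 (t *: v); rewrite scalerA mulVf// scale1r invr_ge0 => /(_ t0).
    by rewrite -ler_pdivlMr// mulrC.
  lra.
have hlb x : has_lbound (A x).
  by exists (- p (- x)) => _ [t t0 <-]; apply: lb.
have A0 x : A x !=set0 by exists (p (x + 0 *: v) - 0 * p v); exists 0 => /=.
have qle x t : 0 <= t -> q x <= p (x + t *: v) - t * p v.
  by move=> t0; apply: ge_inf => //; exists t.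
exists q; split.
- split=> [x y|c x c0].
    rewrite -lerBlDr; apply: lb_le_inf => // _ [t t0 <-].
    rewrite lerBlDr -lerBlDl; apply: lb_le_inf => // _ [u u0 <-]; rewrite lerBlDl.
    apply: le_trans (qle (x + y) (t + u) (addr_ge0 t0 u0)) _.
    by rewrite scalerDl addrACA mulrDl opprD [leRHS]addrACA lerD2r.
  have [->|cn0] := eqVneq c 0.
    rewrite scale0r mul0r; apply: le_trans (qle 0 0 (lexx _)) _.
    by rewrite scale0r mul0r addr0 subr0 sublinear0.
  have cp : 0 < c by rewrite lt_neqAle eq_sym cn0.
  rewrite -ler_pdivrMl//; apply: lb_le_inf => // _ [t t0 <-].
  rewrite ler_pdivrMl//; apply: le_trans (qle _ (c * t) (mulr_ge0 c0 t0)) _.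
  by rewrite -scalerA -scalerDr mulrBr mulrA lerD2r pZ.
- by move=> x; apply: le_trans (qle x 0 (lexx _)) _; rewrite scale0r mul0r addr0 subr0.
- apply: le_trans (qle _ 1 ler01) _.
  by rewrite scale1r addNr sublinear0// mul1r add0r.
Qed.

(** A direction along which a sublinear function is linear remains so for every
    smaller sublinear function, hence the directions can be treated one after
    the other. *)
Lemma sublinear_flatten_seq V (s : seq V) (p : V -> R) : sublinear p ->
  exists q : V -> R, [/\ sublinear q, (forall x, q x <= p x) &
    forall v c, v \in s -> q (c *: v) = c * q v].
Proof.
elim: s p => [|v s IH] p sp; first by exists p; split.
have [q [sq qp qv]] := sublinear_flatten v sp.
have [r [sr rq rs]] := IH q sq; exists r; split => //.
  by move=> x; apply: le_trans (qp x).
move=> w c; rewrite inE => /orP[/eqP ->|]; last exact: rs.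
have rvN : r (- v) = - r v.
  have := sublinearN v sr; have := rq (- v); have := rq v; have := qp v.
  have := sublinearN v sq; lra.
have rpos d : 0 <= d -> r (d *: v) = d * r v.
  move=> d0; have := sr.2 d v d0; have := sublinearN (d *: v) sr.
  by have := sr.2 d (- v) d0; rewrite rvN scalerN; lra.
have [c0|/ltW c0] := leP 0 c; first exact: rpos.
have cN : 0 <= - c by rewrite oppr_ge0.
have := sr.2 _ (- v) cN; rewrite scalerN scaleNr opprK rvN => h1.
have := sr.2 _ v cN; rewrite scaleNr => h2.
have := sublinearN (c *: v) sr; lra.
Qed.

Lemma seminorm_sublinear V (N : V -> R) : seminorm N -> sublinear N.
Proof.
by move=> [ND NZ]; split=> // c x c0; rewrite NZ ger0_norm.
Qed.

End Sublinear.

Section Euclid.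
Context {R : realType} {n : nat}.
Implicit Types (x y : 'rV[R]_n) (N : 'rV[R]_n -> R).

Definition dotr x y : R := \sum_i x 0 i * y 0 i.
Definition enorm x : R := Num.sqrt (dotr x x).
Definition stdb : seq 'rV[R]_n := [seq delta_mx 0 i | i <- enum 'I_n].

Lemma dotrC x y : dotr x y = dotr y x.
Proof. by apply: eq_bigr => i _; rewrite mulrC. Qed.

Lemma dotrDl x x' y : dotr (x + x') y = dotr x y + dotr x' y.
Proof. by rewrite -big_split; apply: eq_bigr => i _; rewrite mxE mulrDl. Qed.

Lemma dotrZl a x y : dotr (a *: x) y = a * dotr x y.
Proof. by rewrite mulr_sumr; apply: eq_bigr => i _; rewrite mxE mulrA. Qed.

Lemma dotr0l y : dotr 0 y = 0.
Proof. by rewrite -[0](scale0r 0) dotrZl mul0r. Qed.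

Lemma dotrNl x y : dotr (- x) y = - dotr x y.
Proof. by rewrite -scaleN1r dotrZl mulN1r. Qed.

Lemma dotr_ge0 x : 0 <= dotr x x.
Proof. by apply: sumr_ge0 => i _; rewrite -expr2 sqr_ge0. Qed.

Lemma enorm_ge0 x : 0 <= enorm x.
Proof. exact: sqrtr_ge0. Qed.

Lemma enorm_sqr x : enorm x ^+ 2 = dotr x x.
Proof. by rewrite sqr_sqrtr// dotr_ge0. Qed.

Lemma enormZ a x : enorm (a *: x) = `|a| * enorm x.
Proof.
rewrite /enorm dotrZl dotrC dotrZl mulrA -expr2 sqrtrM ?sqr_ge0//.
by rewrite sqrtr_sqr.
Qed.

Lemma enorm_eq0 x : (enorm x == 0) = (x == 0).
Proof.
apply/idP/eqP => [|->]; last by rewrite -(scale0r 0) enormZ normr0 mul0r.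
rewrite sqrtr_eq0 => h; apply/rowP => i; rewrite mxE; apply/eqP.
have : dotr x x == 0 by rewrite eq_le h dotr_ge0.
rewrite psumr_eq0 => [/allP/(_ i)|j _]; last by rewrite -expr2 sqr_ge0.
by rewrite mem_index_enum => /(_ isT); rewrite -expr2 sqrf_eq0.
Qed.

Lemma cauchy_schwarz x y : dotr x y <= enorm x * enorm y.
Proof.
have [->|xn0] := eqVneq x 0.
  by rewrite -(scale0r 0) dotrZl enormZ normr0 !mul0r.
have [->|yn0] := eqVneq y 0.
  by rewrite -(scale0r 0) dotrC dotrZl enormZ normr0 mulrCA !mul0r.
set a := enorm x; set b := enorm y.
have a0 : 0 < a by rewrite lt_neqAle eq_sym enorm_eq0 xn0 enorm_ge0.
have b0 : 0 < b by rewrite lt_neqAle eq_sym enorm_eq0 yn0 enorm_ge0.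
have := dotr_ge0 (b *: x - a *: y).
rewrite -scaleNr !(dotrDl, dotrZl) ![dotr _ (_ + _)]dotrC !(dotrDl, dotrZl).
rewrite [dotr y x]dotrC -!enorm_sqr -/a -/b => h.
have : 0 <= 2 * (a * b) * (a * b - dotr x y).
  by apply: le_trans h _; apply: le_of_eq; ring.
by rewrite pmulr_rge0 ?mulr_gt0// subr_ge0.
Qed.

Lemma stdb_sum x : x = \sum_i x 0 i *: delta_mx 0 i.
Proof. exact: row_sum_delta. Qed.

Lemma dotr_delta i y : dotr (delta_mx 0 i) y = y 0 i.
Proof.
rewrite /dotr (bigD1 i)//= big1 ?addr0 => [|j ji]; first by rewrite mxE !eqxx mul1r.
by rewrite mxE eqxx (negPf ji) mul0r.
Qed.

Lemma sublinear_sum (V : lmodType R) (p : V -> R) (I : Type) (r : seq I) (F : I -> V) :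
  sublinear p -> p (\sum_(i <- r) F i) <= \sum_(i <- r) p (F i).
Proof.
move=> sp; elim/big_rec2: _ => [|i y1 y2 _ h]; first by rewrite sublinear0.
by apply: le_trans (sp.1 _ _) _; rewrite lerD2l.
Qed.

Lemma norming_functional N x0 : seminorm N ->
  exists2 y, (forall v, dotr v y <= N v) & dotr x0 y = N x0.
Proof.
move=> sN; have [q [sq qN qx]] := sublinear_flatten x0 (seminorm_sublinear sN).
have [r [sr rq rs]] := sublinear_flatten_seq stdb sq.
pose y := \row_i r (delta_mx 0 i).
have dE v : dotr v y = \sum_i r (v 0 i *: delta_mx 0 i).
  apply: eq_bigr => i _; rewrite mxE rs//.
  by apply/mapP; exists i; rewrite // mem_enum.
have up v : r v <= dotr v y by rewrite dE {1}(stdb_sum v); apply: sublinear_sum.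
have dn v : dotr v y <= r v.
  by have := up (- v); rewrite dotrNl; have := sublinearN v sr; lra.
exists y => [v|]; first by apply: le_trans (dn v) _; apply: le_trans (rq v) _; apply: qN.
apply/le_anti/andP; split.
  by apply: le_trans (dn _) _; apply: le_trans (rq _) _; apply: qN.
apply: le_trans (up x0); have := sublinearN x0 sr; have := rq (- x0); lra.
Qed.

End Euclid.

(** * Projection along random sign vectors *)
Section LowMstar.
Context {R : realType}.

Section Symmetrization.
Variables (V : lmodType R) (T : Type) (L : set T) (phi : V -> T -> R) (kap : T -> R).
Variable es : seq V.
Hypothesis L0 : L !=set0.
Hypothesis phiD : forall a b x, phi (a + b) x = phi a x + phi b x.
Hypothesis phi_bnd : forall a, exists M, forall x, L x -> `|phi a x| <= M.
Hypothesis kap_le : forall x, kap x <= rademacher es (fun a => `|phi a x|).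
Implicit Types u w : T -> R.

Definition ubounded u : Prop := exists M, forall x, L x -> u x <= M.
Definition supL u : R := sup (u @` L).

Lemma supL_ub u x : ubounded u -> L x -> u x <= supL u.
Proof.
move=> [M hM] Lx; apply: ub_le_sup; last by exists x.
by exists M => _ [y Ly <-]; apply: hM.
Qed.

Lemma supL_le u c : (forall x, L x -> u x <= c) -> supL u <= c.
Proof.
move=> h; apply: ge_sup; last by move=> _ [y Ly <-]; apply: h.
by case: L0 => x Lx; exists (u x); exists x.
Qed.

Lemma supL_add u w c : ubounded u -> ubounded w ->
  (forall x y, L x -> L y -> u x + w y <= c) -> supL u + supL w <= c.
Proof.
move=> bu bw h; rewrite -lerBrDr; apply: supL_le => x Lx.
rewrite lerBrDr addrC -lerBrDr; apply: supL_le => y Ly.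
by rewrite lerBrDr addrC h.
Qed.

Lemma phi0 x : phi 0 x = 0.
Proof. by apply: (addrI (phi 0 x)); rewrite -phiD !addr0. Qed.

Lemma phiN a x : phi (- a) x = - phi a x.
Proof. by apply: (addrI (phi a x)); rewrite -phiD !subrr phi0. Qed.

Lemma ubounded_phi u a c : ubounded u -> ubounded (fun x => u x + c * phi a x).
Proof.
move=> [M hM]; have [K hK] := phi_bnd a; exists (M + `|c| * K) => x Lx.
apply: lerD; first exact: hM.
by apply: le_trans (ler_norm _) _; rewrite normrM ler_wpM2l// hK.
Qed.

Lemma ubounded_absphi u a c : ubounded u -> ubounded (fun x => u x + c * `|phi a x|).
Proof.
move=> [M hM]; have [K hK] := phi_bnd a; exists (M + `|c| * K) => x Lx.
apply: lerD; first exact: hM.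
by apply: le_trans (ler_norm _) _; rewrite normrM normr_id ler_wpM2l// hK.
Qed.

Lemma ubounded_kap u : ubounded u -> ubounded (fun x => u x + kap x).
Proof.
have [K hK] : exists K : V -> R, forall a x, L x -> `|phi a x| <= K a.
  by exists (fun a => sval (cid (phi_bnd a))) => a x; case: cid => /= M; apply.
move=> [M hM]; exists (M + rademacher es K) => x Lx.
apply: lerD; first exact: hM.
by apply: le_trans (kap_le x) _; apply: rad_le => a; apply: hK.
Qed.

(** The contraction principle for a single sign: | |s| - |t| | <= |s - t|, and
    s - t and t - s are both accounted for on the right. *)
Lemma contraction_step u a : ubounded u ->
  supL (fun x => u x + 2 * `|phi a x|) + supL (fun x => u x - 2 * `|phi a x|)
  <= supL (fun x => u x + 2 * phi a x) + supL (fun x => u x + 2 * phi (- a) x).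
Proof.
move=> bu; apply: supL_add; first exact: ubounded_absphi.
  have [M hM] := ubounded_absphi a (- 2) bu.
  by exists M => x Lx; have := hM x Lx; rewrite mulNr.
move=> x y Lx Ly.
have P z : L z -> u z + 2 * phi a z <= supL (fun x => u x + 2 * phi a x).
  by move=> Lz; apply: (@supL_ub (fun x => u x + 2 * phi a x)) => //; apply: ubounded_phi.
have Q z : L z -> u z - 2 * phi a z <= supL (fun x => u x + 2 * phi (- a) x).
  move=> Lz; rewrite -mulrN -phiN.
  by apply: (@supL_ub (fun x => u x + 2 * phi (- a) x)) => //; apply: ubounded_phi.
have := P x Lx; have := P y Ly; have := Q x Lx; have := Q y Ly.
move: (supL _) (supL _) => s1 s2.
by case: (ger0P (phi a x)); case: (ger0P (phi a y)); lra.
Qed.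

(** Bound [kap] by the average of |phi b| over an independent copy b of a.  Then
    |phi b| - |phi a| splits into two halves that depend on a single random
    vector, and contraction removes the absolute values. *)
Lemma symmetrization_step u : ubounded u ->
  rademacher es (fun a => supL (fun x => u x + kap x - `|phi a x|)) <=
  rademacher es (fun a => supL (fun x => u x + 2 * phi a x)).
Proof.
move=> bu.
have bm a : ubounded (fun x => u x - 2 * `|phi a x|).
  have [M hM] := ubounded_absphi a (- 2) bu.
  by exists M => x Lx; have := hM x Lx; rewrite mulNr.
have bp a : ubounded (fun x => u x + 2 * `|phi a x|) by apply: ubounded_absphi.
(* G a b bounds supL (u + |phi b| - |phi a|), by convexity of supL. *)
pose G a b := (supL (fun x => u x + 2 * `|phi b x|) + supL (fun x => u x - 2 * `|phi a x|)) / 2.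
apply: (@le_trans _ _ (rademacher es (fun a => rademacher es (G a)))).
  apply: rad_le => a; apply: supL_le => x Lx.
  apply: (@le_trans _ _ (rademacher es (fun b => (u x - `|phi a x|) + `|phi b x|))).
    by rewrite radD rad_cst; have := kap_le x; lra.
  apply: rad_le => b; rewrite /G.
  have := @supL_ub _ x (bp b) Lx; have := @supL_ub _ x (bm a) Lx.
  by rewrite /=; lra.
have -> : rademacher es (fun a => rademacher es (G a)) = rademacher es (fun a => G a a).
  have E a : rademacher es (G a) =
     2^-1 * rademacher es (fun b => supL (fun x => u x + 2 * `|phi b x|)) +
     2^-1 * supL (fun x => u x - 2 * `|phi a x|).
    by rewrite -radZ -[X in _ + X](rad_cst es) -radD; apply: eq_rad => b; rewrite /G; lra.
  rewrite (eq_rad es E) radD rad_cst -radZ -radD; apply: eq_rad => a; rewrite /G; lra.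
have E : rademacher es (fun a => supL (fun x => u x + 2 * phi a x)) =
   rademacher es (fun a => (supL (fun x => u x + 2 * phi a x) + supL (fun x => u x + 2 * phi (- a) x)) / 2).
  under [RHS]eq_rad do rewrite mulrDl mulrC [X in _ + X]mulrC.
  by rewrite radD !radZ (radN es (fun a => supL (fun x => u x + 2 * phi a x))); lra.
rewrite E; apply: rad_le => a; rewrite /G ler_pM2r ?invr_gt0//.
exact: contraction_step.
Qed.

(** The additional function [u] collects the terms of the random vectors that
    are already fixed; this is what lets [symmetrization_step] be iterated. *)
Lemma symmetrization k u : ubounded u ->
  exists2 s : seq V, size s = k &
  supL (fun x => u x + \sum_(a <- s) (kap x - `|phi a x|)) <=
  rademacher (fam (nseq k 1) es) (fun z => supL (fun x => u x + 2 * phi z x)).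
Proof.
elim: k u => [|k IH] u bu.
  exists [::] => //=; apply: le_of_eq.
  by congr supL; apply: funext => x; rewrite big_nil phi0 mulr0.
have h a : ubounded (fun x => u x + kap x - `|phi a x|).
  have [M hM] := ubounded_absphi a (- 1) (ubounded_kap bu).
  by exists M => x Lx; have := hM x Lx; rewrite mulN1r.
have [a ha] := rad_exists es (fun a => rademacher (fam (nseq k 1) es)
   (fun z => supL (fun x => (u x + kap x - `|phi a x|) + 2 * phi z x))).
have [s ss hs] := IH _ (h a); exists (a :: s); first by rewrite /= ss.
have -> : (fun x => u x + \sum_(b <- a :: s) (kap x - `|phi b x|)) =
   (fun x => (u x + kap x - `|phi a x|) + \sum_(b <- s) (kap x - `|phi b x|)).
  by apply: funext => x; rewrite big_cons !addrA.
apply: le_trans hs _; apply: le_trans ha _.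
rewrite -[nseq k.+1 1]/(1 :: nseq k 1) fam_cons rad_cat.
have -> : [seq 1 *: e | e <- es] = es by rewrite -[RHS]map_id; apply: eq_map => e; rewrite scale1r.
rewrite rad_swap [leRHS]rad_swap; apply: rad_le => z.
have E b : supL (fun x => u x + 2 * phi (b + z) x) =
  supL (fun x => (u x + 2 * phi z x) + 2 * phi b x).
  by congr supL; apply: funext => x; rewrite phiD mulrDr [_ + 2 * phi z x]addrC addrA.
rewrite [leRHS](eq_rad _ E).
apply: le_trans (symmetrization_step (ubounded_phi z 2 bu)).
apply: rad_le => b; apply: le_of_eq.
by congr supL; apply: funext => x; rewrite [LHS]addrC !addrA [2 * _ + _]addrC.
Qed.

End Symmetrization.

Section Quotient.
Variable n : nat.
Implicit Types (x y : 'rV[R]_n) (N P : 'rV[R]_n -> R).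

(** As m grows this tends to the average of N over Gaussian vectors. *)
Definition ell N (m : nat) : R :=
  rademacher (fam (nseq m (Num.sqrt m%:R)^-1) stdb) N.

Lemma rad_fam_nseq N m (c d : R) : seminorm N ->
  rademacher (fam (nseq m (c * d)) stdb) N = `|c| * rademacher (fam (nseq m d) stdb) N.
Proof.
move=> sN; rewrite -radZ.
have -> : nseq m (c * d) = map ( *%R c) (nseq m d) by rewrite map_nseq.
rewrite fam_map rad_map; last by move=> x y; rewrite scalerDr.
by apply: eq_rad => x; rewrite seminormZ.
Qed.

Lemma rad_ell N m : (0 < m)%N -> seminorm N ->
  rademacher (fam (nseq m 1) stdb) N = Num.sqrt m%:R * ell N m.
Proof.
move=> m0 sN; have h : Num.sqrt m%:R != 0 :> R by rewrite sqrtr_eq0 -ltNge ltr0n.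
rewrite -[X in nseq m X](mulfV h) rad_fam_nseq// ger0_norm//; exact: sqrtr_ge0.
Qed.

Lemma khintchine_stdb y : enorm y / 2 <= rademacher stdb (fun a => `|dotr a y|).
Proof.
rewrite -(@rad_map _ _ R^o (fun a => dotr a y) stdb (fun t : R^o => `|t : R|)); last first.
  by move=> a b; rewrite dotrDl.
apply: le_trans (khintchine _); rewrite ler_pM2r ?invr_gt0//.
rewrite /enorm le_eqVlt; apply/orP; left; apply/eqP; congr Num.sqrt.
rewrite /sumsq /stdb -map_comp big_map big_enum [LHS]/dotr; apply: eq_bigr => i _ /=.
by rewrite dotr_delta expr2.
Qed.

(** Apply [symmetrization] to L = {y | <., y> <= N}, phi a y = <a, y> and
    [kap] y = |y| / 2.  If y in L is orthogonal to the k vectors, then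
    k |y| / 2 is at most twice the average of N over the sum of k sign
    vectors, that is 2 sqrt k [ell N k].  A functional norming P at a point is
    such a y. *)
Lemma low_mstar N k : seminorm N -> (0 < k)%N ->
  exists2 s : seq 'rV[R]_n, size s = k &
  forall P, seminorm P -> (forall x, P x <= N x) -> (forall a, a \in s -> P a = 0) ->
  forall x, P x <= 4 * ell N k / Num.sqrt k%:R * enorm x.
Proof.
move=> sN k0.
pose L : set 'rV[R]_n := [set y | forall v, dotr v y <= N v].
have L0 : L !=set0.
  exists 0 => v; rewrite dotrC -(scale0r 0) dotrZl mul0r; exact: seminorm_ge0.
have bphi a : exists M, forall y, L y -> `|dotr a y| <= M.
  exists (N a) => y Ly; rewrite ler_norml Ly andbT lerNl -dotrNl.
  by apply: le_trans (Ly _) _; rewrite seminormN.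
have b0 : ubounded L (fun=> 0) by exists 0.
have [s ss hs] := symmetrization L0 dotrDl bphi khintchine_stdb k b0.
exists s => // P sP PN P0 x.
have [y hy <-] := norming_functional x sP.
have Ly : L y by move=> v; apply: le_trans (hy v) (PN v).
apply: le_trans (cauchy_schwarz _ _) _; rewrite mulrC ler_wpM2r ?enorm_ge0//.
have ky : k%:R * (enorm y / 2) <= 2 * (Num.sqrt k%:R * ell N k).
  rewrite -rad_ell// -radZ.
  apply: (@le_trans _ _ (supL L (fun y => 0 + \sum_(a <- s) (enorm y / 2 - `|dotr a y|)))).
    have bu : ubounded L (fun y => 0 + \sum_(a <- s) (enorm y / 2 - `|dotr a y|)).
      exists (\sum_(a <- s) rademacher stdb N) => z Lz; rewrite add0r.
      apply: ler_sum => a _; rewrite lerBlDr; apply: le_trans (khintchine_stdb z) _.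
      rewrite -[leLHS]addr0; apply: lerD => //; apply: rad_le => b.
      rewrite ler_norml Lz andbT lerNl -dotrNl.
      by apply: le_trans (Lz _) _; rewrite seminormN.
    apply: le_trans (supL_ub bu Ly); rewrite add0r.
    rewrite (eq_big_seq (fun=> enorm y / 2)); last first.
      move=> a sa /=; have := hy a; have := hy (- a); rewrite dotrNl seminormN// P0//.
      rewrite oppr_le0 => h1 h2; have -> : dotr a y = 0 by apply/le_anti; rewrite h1 h2.
      by rewrite normr0 subr0.
    by rewrite -ss mulr_natl; elim: s {ss hs P0 bu} => [|a s IH]; rewrite ?big_nil// big_cons /= mulrS lerD2l.
  apply: le_trans hs _; apply: rad_le => z; apply: (supL_le L0) => w Lw.
  by rewrite add0r ler_wpM2l.
set r := Num.sqrt _ in ky *.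
have r0 : 0 < r by rewrite sqrtr_gt0 ltr0n.
rewrite ler_pdivlMr//; rewrite -(@sqr_sqrtr _ k%:R) ?ler0n// -/r in ky.
rewrite -(ler_pM2l r0).
have -> : r * (enorm y * r) = 2 * (r ^+ 2 * (enorm y / 2)) by field.
by rewrite [leRHS](_ : _ = 2 * (2 * (r * ell N k)));[rewrite ler_wpM2l | ring].
Qed.

End Quotient.
End LowMstar.

(** * A net of the Euclidean ball *)
Section Net.
Context {R : realType}.

Lemma enorm_seminorm n : seminorm (@enorm R n).
Proof.
split; last exact: enormZ.
move=> x y; rewrite -(@ler_pXn2r _ 2) ?nnegrE ?addr_ge0 ?enorm_ge0//.
rewrite enorm_sqr sqrrD !enorm_sqr dotrDl ![dotr _ (x + y)]dotrC !dotrDl [dotr y x]dotrC.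
have := cauchy_schwarz x y; rewrite mulr2n; lra.
Qed.

Lemma coord_le_enorm n (x : 'rV[R]_n) i : `|x 0 i| <= enorm x.
Proof.
rewrite -(@ler_pXn2r _ 2) ?nnegrE ?enorm_ge0//.
rewrite enorm_sqr real_normK ?num_real// /dotr (bigD1 i)//= expr2 lerDl.
by apply: sumr_ge0 => j _; rewrite -expr2 sqr_ge0.
Qed.

Lemma enorm_le_coord n (x : 'rV[R]_n) (c : R) :
  0 <= c -> (forall i, `|x 0 i| <= c) -> enorm x <= Num.sqrt n%:R * c.
Proof.
move=> c0 h; rewrite -(@ler_pXn2r _ 2) ?nnegrE ?enorm_ge0 ?mulr_ge0 ?sqrtr_ge0//.
rewrite enorm_sqr exprMn sqr_sqrtr ?ler0n// /dotr.
apply: (@le_trans _ _ (\sum_(i < n) c ^+ 2)); last first.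
  by rewrite sumr_const card_ord mulr_natl.
apply: ler_sum => i _; rewrite -expr2 -[x 0 i ^+ 2]real_normK ?num_real//.
by rewrite ler_pXn2r ?nnegrE.
Qed.

Variable d : nat.
Hypothesis d0 : (0 < d)%N.

(** A sign and an absolute value for each coordinate, in units of
    1 / (16 sqrt d).  That zero occurs twice is harmless, since sums over the
    mesh are only bounded from above. *)
Definition mesh : finType := {ffun 'I_d -> bool * 'I_(16 * d).+1}.

Definition meshz (p : bool * 'I_(16 * d).+1) : R := (-1) ^+ p.1 * p.2%:R.

Definition meshpt (z : mesh) : 'rV[R]_d :=
  \row_j (meshz (z j) / (16 * Num.sqrt d%:R)).

Definition inball (z : mesh) : bool := (\sum_j (z j).2 ^ 2 <= 256 * d)%N.

Let s := Num.sqrt d%:R : R.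
Let s0 : 0 < s. Proof. by rewrite sqrtr_gt0 ltr0n. Qed.
Let s2 : s ^+ 2 = d%:R. Proof. by rewrite sqr_sqrtr ?ler0n. Qed.

Lemma meshz_sqr p : meshz p ^+ 2 = (p.2 ^ 2)%N%:R.
Proof. by rewrite /meshz exprMn sqrr_sign mul1r natrX. Qed.

Lemma enorm_meshpt z : enorm (meshpt z) ^+ 2 = (\sum_j (z j).2 ^ 2)%N%:R / (256 * d%:R).
Proof.
rewrite enorm_sqr /dotr natr_sum mulr_suml; apply: eq_bigr => j _.
rewrite mxE -expr2 expr_div_n meshz_sqr exprMn -/s s2; congr (_ / (_ * _)).
by rewrite -natrX.
Qed.

Lemma inballE z : inball z = (enorm (meshpt z) <= 1).
Proof.
rewrite -(@ler_pXn2r _ 2) ?nnegrE ?enorm_ge0// enorm_meshpt expr1n.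
by rewrite ler_pdivrMr ?mul1r ?mulr_gt0 ?ltr0n// -natrM ler_nat.
Qed.

(** Round every coordinate towards zero: the norm does not grow, and each of the
    d coordinates changes by at most 1 / (16 sqrt d). *)
Lemma mesh_approx (x : 'rV[R]_d) : enorm x <= 1 ->
  exists2 z, inball z & enorm (x - meshpt z) <= 1 / 16.
Proof.
move=> x1.
pose t j : nat := Num.truncn (`|x 0 j| * (16 * s)).
have tp j : 0 <= `|x 0 j| * (16 * s) by rewrite !mulr_ge0// ltW.
have s16 : 0 < 16 * s by rewrite mulr_gt0.
have tl j : (t j)%:R <= `|x 0 j| * (16 * s) by have /andP[] := truncn_itv (tp j).
have tu j : `|x 0 j| * (16 * s) <= (t j)%:R + 1.
  by have /andP[_ /ltW] := truncn_itv (tp j); rewrite natr1.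
have s1 : 1 <= s by rewrite /s -[X in X <= _]sqrtr1 ler_wsqrtr// ler1n.
have sd : s <= d%:R by rewrite -s2 expr2 ler_peMr// ltW.
have tb j : (t j < (16 * d).+1)%N.
  rewrite ltnS -(ler_nat R); apply: le_trans (tl j) _; rewrite natrM.
  apply: (@le_trans _ _ (1 * (16 * s))); last by rewrite mul1r ler_pM2l.
  by rewrite ler_pM2r//; apply: le_trans (coord_le_enorm x j) x1.
pose z : mesh := [ffun j => (x 0 j < 0, Ordinal (tb j))].
have zE j : meshpt z 0 j = (-1) ^+ (x 0 j < 0)%R * ((t j)%:R / (16 * s)).
  by rewrite mxE ffunE /meshz /= mulrA.
have xE j : x 0 j = (-1) ^+ (x 0 j < 0)%R * `|x 0 j| by rewrite -numEsign.
exists z.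
  rewrite inballE; apply: le_trans x1; rewrite ler_sqrt ?dotr_ge0//.
  apply: ler_sum => j _; rewrite -!expr2 zE exprMn sqrr_sign mul1r.
  rewrite -[leRHS]real_normK ?num_real// ler_pXn2r ?nnegrE ?divr_ge0 ?ler0n ?(ltW s16)//.
  by rewrite ler_pdivrMr.
have c0 : 0 <= 1 / (16 * s) by rewrite divr_ge0// ltW.
have -> : 1 / 16 = s * (1 / (16 * s)) :> R by field; rewrite gt_eqF.
apply: (enorm_le_coord c0) => j.
rewrite mxE [in X in _ + X]mxE zE {1}xE -mulrBr normrM normr_sign !mul1r.
have ge : 0 <= `|x 0 j| - (t j)%:R / (16 * s) by rewrite subr_ge0 ler_pdivrMr.
by rewrite (ger0_norm ge) lerBlDr -[X in X + _]mul1r -mulrDl ler_pdivlMr// addrC.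
Qed.

(** The maximum S of P over the unit ball satisfies S <= u + S / 16, because
    every point is within 1 / 16 of a mesh point of the ball. *)
Lemma net_extend (P : 'rV[R]_d -> R) (u l tau : R) : seminorm P ->
  (forall z, inball z -> P (meshpt z) <= u) ->
  (forall z, inball z -> l * enorm (meshpt z) - tau <= P (meshpt z)) -> 0 <= l ->
  forall x, enorm x = 1 ->
    P x <= 16 / 15 * u /\ 15 / 16 * l - tau - u / 15 <= P x.
Proof.
move=> sP hu hl l0.
pose D := [set P x | x in [set x | enorm x <= 1]]; pose S := sup D.
have hD : has_ubound D.
  exists (\sum_j P (delta_mx 0 j)) => _ [x /= x1 <-].
  rewrite {1}(stdb_sum x); apply: le_trans (seminorm_sum sP _ _ _) _.
  apply: ler_sum => j _; rewrite seminormZ//; apply: ler_piMl; first exact: seminorm_ge0.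
  exact: le_trans (coord_le_enorm x j) x1.
have PS x : enorm x <= 1 -> P x <= S by move=> x1; apply: ub_le_sup => //; exists x.
have P16 x : enorm x <= 1 / 16 -> P x <= S / 16.
  move=> x1; have h : enorm (16 *: x) <= 1 by rewrite enormZ ger0_norm//; lra.
  by have := PS _ h; rewrite seminormZ// ger0_norm//; lra.
have Su : S <= 16 / 15 * u.
  have : S <= u + S / 16.
    apply: ge_sup => [|_ [x /= x1 <-]].
      by exists (P 0); exists 0 => //=; rewrite (seminorm0 (enorm_seminorm d)).
    have [z zb hz] := mesh_approx x1.
    rewrite -[x](subrK (meshpt z)) addrC; apply: le_trans (seminormD sP _ _) _.
    by apply: lerD; [exact: hu | exact: P16].
  lra.
move=> x x1; have x1' : enorm x <= 1 by rewrite x1.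
split; first by apply: le_trans (PS _ x1') _.
have [z zb hz] := mesh_approx x1'.
have h1 := hl z zb; have h2 := P16 _ hz.
have h3 : P (meshpt z) - P x <= P (x - meshpt z).
  by rewrite -(seminormN sP (x - _)) opprB seminormB.
have h4 : 1 - enorm (meshpt z) <= 1 / 16.
  by apply: le_trans hz; rewrite -x1 (seminormB (enorm_seminorm d)).
have h5 : l * (15 / 16) <= l * enorm (meshpt z) by apply: ler_wpM2l => //; lra.
lra.
Qed.

Lemma geo_half m : \sum_(i < m) (1 / 2 : R) ^+ i <= 2.
Proof.
suff -> : \sum_(i < m) (1 / 2 : R) ^+ i = 2 - 2 * (1 / 2) ^+ m.
  by rewrite gerBl mulr_ge0// exprn_ge0//; lra.
elim: m => [|m IH]; first by rewrite big_ord0 expr0; ring.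
by rewrite big_ord_recr /= IH exprS; field.
Qed.

(** Weights take the place of counting the net: their sum over the mesh is at
    most 4^d, and a point of the ball has weight at least 2^(- 256 d) because
    i <= i^2. *)
Definition weight (z : mesh) : R := \prod_j (1 / 2) ^+ (z j).2.

Lemma weight_sum : \sum_(z : mesh) weight z <= 4 ^+ d.
Proof.
rewrite /weight -(bigA_distr_bigA (fun (j : 'I_d) (p : bool * 'I_(16 * d).+1) => (1 / 2 : R) ^+ p.2)).
rewrite prodr_const card_ord; apply: lerXn2r; rewrite ?nnegrE//.
  by apply: sumr_ge0 => p _; rewrite exprn_ge0//; lra.
rewrite -(pair_big xpredT xpredT (fun (b : bool) (i : 'I_(16 * d).+1) => (1 / 2 : R) ^+ i))/=.
rewrite big_bool /=; have := geo_half (16 * d).+1; lra.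
Qed.

Lemma weight_gt0 z : 0 < weight z.
Proof. by apply: prodr_gt0 => j _; rewrite exprn_gt0//; lra. Qed.

Lemma weight_inball z : inball z -> (1 / 2) ^+ (256 * d) <= weight z.
Proof.
move=> zb; rewrite /weight prodrXr; apply: ler_wiXn2l; rewrite ?divr_ge0//; first by lra.
apply: leq_trans zb; apply: leq_sum => j _.
by case: (nat_of_ord _) => // m; rewrite expnS expn1 leq_pmulr.
Qed.

End Net.

(** * Mean values over random sign matrices *)
Section EllFacts.
Context {R : realType} {n : nat}.
Implicit Types (N : 'rV[R]_n -> R) (x y : 'rV[R]_n).

Lemma sum_sqr_fam (cs : seq R) (w : 'rV[R]_n) :
  \sum_(v <- fam cs stdb) dotr v w ^+ 2 = sumsq cs * dotr w w.
Proof.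
rewrite /fam big_allpairs_dep /sumsq mulr_suml; apply: eq_bigr => c _ /=.
rewrite /stdb big_map big_enum [in RHS]/dotr mulr_sumr; apply: eq_bigr => i _ /=.
by rewrite dotrZl dotr_delta exprMn -expr2.
Qed.

(** The Lipschitz constant needed for [concentration], found by testing the sum
    against itself with the Cauchy-Schwarz inequality. *)
Lemma enorm_fam (cs : seq R) (c : nat -> R) :
  enorm (\sum_(i < size (fam cs (@stdb R n))) c i *: nth 0 (fam cs (@stdb R n)) i)
  <= Num.sqrt (sumsq cs) * Num.sqrt (\sum_(i < size (fam cs (@stdb R n))) c i ^+ 2).
Proof.
set s := fam cs (@stdb R n); set w := \sum_i _.
have [->|wn0] := eqVneq w 0.
  by rewrite (seminorm0 (enorm_seminorm n)) mulr_ge0// sqrtr_ge0.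
have w0 : 0 < enorm w by rewrite lt_neqAle eq_sym enorm_eq0 wn0 enorm_ge0.
rewrite -(ler_pM2r w0) -expr2 enorm_sqr.
pose a : 'rV[R]_(size s) := \row_i c i.
pose b : 'rV[R]_(size s) := \row_i dotr (nth 0 s i) w.
have -> : dotr w w = dotr a b.
  rewrite {1}/w -[dotr _ w](_ : \sum_(i < size s) dotr (c i *: nth 0 s i) w = _).
    by apply: eq_bigr => i _; rewrite !mxE dotrZl.
  by elim/big_rec2: _ => [|i y1 y2 _ ->]; [rewrite dotr0l | rewrite dotrDl].
have -> : Num.sqrt (\sum_(i < size s) c i ^+ 2) = enorm a.
  by congr Num.sqrt; apply: eq_bigr => i _; rewrite !mxE expr2.
apply: le_trans (cauchy_schwarz a b) _; rewrite [X in _ <= X * _]mulrC -mulrA.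
apply: ler_wpM2l; first exact: enorm_ge0.
have -> : enorm b = Num.sqrt (sumsq cs * dotr w w).
  rewrite -sum_sqr_fam -/s (big_nth 0) big_mkord.
  by congr Num.sqrt; apply: eq_bigr => i _; rewrite !mxE expr2.
by rewrite sqrtrM ?sumsq_ge0.
Qed.

Lemma rad_dotr (s : seq 'rV[R]_n) c :
  rademacher s (fun x => dotr (x + c) (x + c)) = dotr c c + \sum_(v <- s) dotr v v.
Proof.
elim: s c => [|v s IH] c /=; first by rewrite big_nil add0r addr0.
have E u : rademacher s (fun x => dotr (u + x + c) (u + x + c)) =
  dotr (u + c) (u + c) + \sum_(v <- s) dotr v v.
  by rewrite -IH; apply: eq_rad => x; rewrite -addrA addrCA.
rewrite !E big_cons !dotrDl ![dotr _ (_ + c)]dotrC !dotrDl.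
rewrite ![dotr _ (- v)]dotrC !dotrNl ![dotr _ (- v)]dotrC !dotrNl [dotr c v]dotrC.
by field.
Qed.

Lemma sumsq_nseq m (c : R) : sumsq (nseq m c) = m%:R * c ^+ 2.
Proof.
rewrite /sumsq mulr_natl; elim: m => [|m IH]; first by rewrite big_nil.
by rewrite /= big_cons IH mulrS.
Qed.

Lemma ell_bounded N (b : R) m : (0 < m)%N -> 0 <= b -> seminorm N ->
  (forall x, N x <= b * enorm x) -> ell N m <= b * (1 + n%:R).
Proof.
move=> m0 b0 sN Nb.
apply: (@le_trans _ _ (rademacher (fam (nseq m (Num.sqrt m%:R)^-1) stdb)
   (fun x => b * (1 + dotr (x + 0) (x + 0))))).
  apply: rad_le => x; apply: le_trans (Nb x) _; apply: ler_wpM2l => //.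
  by rewrite addr0 -enorm_sqr; have := sqr_ge0 (enorm x - 1); have := enorm_ge0 x; nra.
rewrite radZ radD rad_cst rad_dotr; apply: ler_wpM2l => //; rewrite lerD2l.
rewrite dotr0l add0r /fam big_allpairs_dep /= big_nseq.
have -> : \sum_(e <- @stdb R n) dotr ((Num.sqrt m%:R)^-1 *: e) ((Num.sqrt m%:R)^-1 *: e) =
  n%:R / m%:R.
  rewrite /stdb big_map big_enum /= (eq_bigr (fun=> m%:R^-1)) => [|i _].
    by rewrite sumr_const card_ord mulr_natl.
  rewrite dotrZl dotrC dotrZl dotr_delta mxE !eqxx mulr1 -invfM -expr2.
  by rewrite sqr_sqrtr ?ler0n.
by rewrite iter_addr addr0 -[_ *+ m]mulr_natr divfK// pnatr_eq0 -lt0n.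
Qed.

End EllFacts.

Section Means.
Context {R : realType} {n d : nat}.
Hypothesis d0 : (0 < d)%N.
Variables (N : 'rV[R]_n -> R) (m : nat).
Hypotheses (sN : seminorm N) (m0 : (0 < m)%N).

Let c0 : R := (Num.sqrt m%:R)^-1.

(** The coefficients of the sign vectors whose combination is y A, when the
    entries of the random matrix A are m^(-1/2) times sums of m signs. *)
Definition coefs (y : 'rV[R]_d) : seq R :=
  flatten (nseq m [seq c0 * y 0 j | j <- enum 'I_d]).

Lemma sumsq_coefs y : sumsq (coefs y) = enorm y ^+ 2.
Proof.
have h : sumsq [seq c0 * y 0 j | j <- enum 'I_d] = enorm y ^+ 2 / m%:R.
  rewrite enorm_sqr /sumsq /dotr big_map big_enum mulr_suml; apply: eq_bigr => j _ /=.
  by rewrite exprMn exprVn sqr_sqrtr ?ler0n// mulrC expr2.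
have -> : sumsq (coefs y) = m%:R * (enorm y ^+ 2 / m%:R).
  rewrite /coefs -h; elim: (m) => [|k IH]; first by rewrite /sumsq big_nil mul0r.
  by rewrite /= /sumsq big_cat /= -/(sumsq _) -/(sumsq _) IH -natr1 mulrDl mul1r addrC.
by rewrite mulrCA divff ?mulr1// pnatr_eq0 -lt0n.
Qed.

(** For every copy, the d signs in a column of the matrix refine a single sign
    with coefficient |y| / (2 sqrt m). *)
Lemma mean_lower y :
  enorm y / 2 * ell N m <= rademacher (fam (coefs y) stdb) N.
Proof.
have y0 := enorm_ge0 y.
have c00 : 0 <= c0 by rewrite invr_ge0 sqrtr_ge0.
have h : 0 <= enorm y / 2 by lra.
rewrite -[X in X * _](ger0_norm h) /ell -/c0 -rad_fam_nseq//.
apply: rad_refine; first exact: seminorm_cvx.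
have E : Num.sqrt (sumsq [seq c0 * y 0 j | j <- enum 'I_d]) = c0 * enorm y.
  rewrite /sumsq big_map big_enum /= -[RHS]ger0_norm ?mulr_ge0// -sqrtr_sqr exprMn enorm_sqr.
  congr Num.sqrt; rewrite /dotr mulr_sumr; apply: eq_bigr => j _.
  by rewrite exprMn expr2 -expr2.
elim: (m) => //= k ->; rewrite andbT E ger0_norm ?mulr_ge0//; lra.
Qed.

Lemma flatten_map_nseq (T : Type) (g : T -> nat) (c : R) (r : seq T) :
  flatten [seq nseq (g z) c | z <- r] = nseq (\sum_(z <- r) g z) c.
Proof.
elim: r => [|z r IH] /=; first by rewrite big_nil.
by rewrite big_cons IH -nseqD.
Qed.

(** The squares of the coordinates of a mesh point are the multiples
    i^2 / (256 d), so a sign with coefficient y_j / sqrt m can be refined into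
    i^2 signs with the common coefficient 2 / sqrt (256 d m).  In the ball there
    are altogether at most 256 d m of them, and adding the missing ones
    increases the average to 2 [ell N (256 d m)]. *)
Lemma mean_upper (z : mesh d) (l : R) : inball z ->
  (forall k, (0 < k)%N -> ell N k <= l) ->
  rademacher (fam (coefs (meshpt z)) stdb) N <= 2 * l.
Proof.
move=> zb hl.
pose Q := (m * (256 * d))%N.
have Q0 : (0 < Q)%N by rewrite !muln_gt0 m0 d0.
pose h (p : bool * 'I_(16 * d).+1) : R := c0 * (meshz p / (16 * Num.sqrt d%:R)).
pose g (p : bool * 'I_(16 * d).+1) := (p.2 ^ 2)%N.
pose zl := flatten (nseq m [seq z j | j <- enum 'I_d]).
pose q : R := Num.sqrt Q%:R.
have qE : q = Num.sqrt m%:R * (16 * Num.sqrt d%:R).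
  rewrite /q natrM natrM sqrtrM ?ler0n// sqrtrM ?ler0n//; congr (_ * (_ * _)).
  by rewrite (_ : 256 = 16 ^+ 2) ?sqrtr_sqr ?ger0_norm// -natrX.
have q0 : 0 < q by rewrite sqrtr_gt0 ltr0n.
have -> : coefs (meshpt z) = map h zl.
  rewrite /coefs /zl map_flatten map_nseq; congr (flatten (nseq _ _)).
  by rewrite -[RHS]map_comp; apply: eq_map => j /=; rewrite mxE.
apply: le_trans (@rad_refine _ _ _ _ [seq nseq (g p) (2 * q^-1) | p <- zl] _ _ _) _.
- exact: seminorm_cvx.
- elim: (zl) => //= p r ->; rewrite andbT sumsq_nseq.
  have -> : (g p)%:R * (2 * q^-1) ^+ 2 = (2 * h p) ^+ 2.
    rewrite /g -meshz_sqr /h qE /c0 -!exprMn; congr (_ ^+ 2); rewrite invfM.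
    by move: (_^-1) (_^-1) => u w; ring.
  by rewrite sqrtr_sqr [leRHS]normrM ler_wpM2r// ler_norm.
rewrite flatten_map_nseq; set Z := (\sum_(p <- zl) g p)%N.
have ZQ : (Z <= Q)%N.
  rewrite /Z /zl /Q; have -> : (\sum_(p <- flatten (nseq m [seq z j | j <- enum 'I_d])) g p
     = m * \sum_j g (z j))%N.
    elim: (m) => [|k IH] /=; first by rewrite big_nil mul0n.
    by rewrite big_cat /= IH (mulSn k) big_map big_enum.
  by rewrite leq_mul2l; apply/orP; right.
apply: le_trans (_ : rademacher (fam (nseq Q (2 * q^-1)) stdb) N <= _).
  rewrite -[in leRHS](subnKC ZQ) nseqD fam_cat; apply: rad_sub; exact: seminorm_cvx.
by rewrite rad_fam_nseq// ger0_norm// ler_wpM2l// hl.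
Qed.

End Means.

(** * Dvoretzky's theorem *)
Section Dvoretzky.
Context {R : realType}.

Lemma cvx_expR (c : R) : cvx (fun t : R^o => expR (c * t)).
Proof.
move=> t x y t01; apply: le_trans (expR_mix (c * x) (c * y) t01).
rewrite ler_expR le_eqVlt; apply/orP; left; apply/eqP; rewrite /GRing.scale/=; ring.
Qed.

Section Mgf.
Variables (n d : nat) (N : 'rV[R]_n -> R) (b l : R) (m : nat) (y : 'rV[R]_d).
Hypotheses (sN : seminorm N) (Nb : forall x, N x <= b * enorm x) (b0 : 0 <= b).
Hypotheses (m0 : (0 < m)%N) (l0 : 0 <= l) (y1 : enorm y <= 1).

Let s := fam (coefs m y) (@stdb R n).

Lemma mgf_prod : rademacher s (fun x => expR (l * N x)) * rademacher s (fun x => expR (- (l * N x)))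
  <= expR (16 * (l * b) ^+ 2).
Proof.
apply: concentration => // c; apply: le_trans (Nb _) _; apply: ler_wpM2l => //.
apply: le_trans (enorm_fam _ _) _; rewrite sumsq_coefs// sqrtr_sqr ger0_norm ?enorm_ge0//.
by apply: ler_piMl => //; apply: sqrtr_ge0.
Qed.

(** By Jensen's inequality the second factor in [mgf_prod] is at least e^(- l c). *)
Lemma mgf_upper c : rademacher s N <= c ->
  rademacher s (fun x => expR (l * (N x - c))) <= expR (16 * (l * b) ^+ 2).
Proof.
move=> hc; apply: le_trans mgf_prod.
have -> : (fun x => expR (l * (N x - c))) = (fun x => expR (- (l * c)) * expR (l * N x)).
  by apply: funext => x; rewrite -expRD; congr expR; ring.
rewrite radZ mulrC ler_wpM2l//; first by apply: rad_ge0 => x; apply: expR_ge0.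
have := rad_jensen s N (cvx_expR (- l)); rewrite mulNr.
have -> : (fun x => expR (- l * N x)) = (fun x => expR (- (l * N x))).
  by apply: funext => x; rewrite mulNr.
by apply: le_trans; rewrite ler_expR lerN2 ler_wpM2l.
Qed.

Lemma mgf_lower c : c <= rademacher s N ->
  rademacher s (fun x => expR (l * (c - N x))) <= expR (16 * (l * b) ^+ 2).
Proof.
move=> hc; apply: le_trans mgf_prod.
have -> : (fun x => expR (l * (c - N x))) = (fun x => expR (l * c) * expR (- (l * N x))).
  by apply: funext => x; rewrite -expRD; congr expR; ring.
rewrite radZ ler_wpM2r//; first by apply: rad_ge0 => x; apply: expR_ge0.
have := rad_jensen s N (cvx_expR l).
by apply: le_trans; rewrite ler_expR ler_wpM2l.
Qed.

End Mgf.

Definition mstd n d : seq 'M[R]_(d, n) :=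
  [seq delta_mx j i | j <- enum 'I_d, i <- enum 'I_n].

(** The law of y A for a random sign matrix A. *)
Lemma rad_matrix n d m (y : 'rV[R]_d) (f : 'rV[R]_n -> R) :
  rademacher (fam (nseq m (Num.sqrt m%:R)^-1) (mstd n d)) (fun A => f (y *m A)) =
  rademacher (fam (coefs m y) stdb) f.
Proof.
rewrite -(@rad_map _ _ _ (fun A => y *m A) _ f); last by move=> A B; rewrite mulmxDr.
congr rademacher; rewrite /coefs; set c := _^-1.
have E : map (mulmx y) (mstd n d) = fam [seq y 0 j | j <- enum 'I_d] stdb.
  rewrite /fam /mstd map_allpairs [RHS]allpairs_mapl [RHS]allpairs_mapr.
  congr flatten; apply: eq_map => j; apply: eq_map => i; apply/rowP => k; rewrite !mxE (bigD1 j)//= big1.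
    by rewrite mxE eqxx addr0.
  by move=> j' j'j; rewrite mxE (negPf j'j) mulr0.
elim: (m) => //= k IH.
rewrite fam_cons map_cat IH fam_cat; congr (_ ++ _).
have -> : [seq c * y 0 j | j <- enum 'I_d] = map ( *%R c) [seq y 0 j | j <- enum 'I_d].
  by rewrite -[RHS]map_comp.
rewrite fam_map -E -[LHS]map_comp -[RHS]map_comp; apply: eq_map => A /=.
by rewrite -scalemxAr.
Qed.

(** The union bound: two events for each mesh point, total weight 4^d, smallest
    weight in the ball 2^(- 256 d), and 2 * 4^d * 2^(256 d) <= e^(259 d). *)
Lemma pow_bound (d : nat) (E : R) : (0 < d)%N -> 259 * d%:R <= E ->
  4 ^+ d * (2 * expR (- E)) <= (1 / 2) ^+ (256 * d).
Proof.
move=> d0 dE.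
have e2 : expR (- 1) <= 1 / 2 :> R.
  rewrite expRN div1r lef_pV2 ?posrE ?expR_gt0//.
  by have := expR_ge1Dx (1 : R); lra.
have h : expR (- E) <= (1 / 2) ^+ (259 * d).
  apply: (@le_trans _ _ (expR (- 1) ^+ (259 * d))).
    by rewrite -expRM_natl ler_expR mulrN1 lerN2 natrM.
  by apply: lerXn2r => //; rewrite nnegrE ?expR_ge0//; lra.
apply: (@le_trans _ _ (4 ^+ d * (2 ^+ d * (1 / 2) ^+ (259 * d)))).
  apply: ler_wpM2l; first by rewrite exprn_ge0.
  apply: ler_pM; rewrite ?expR_ge0//.
  by rewrite -[X in X <= _]expr1; apply: ler_weXn2l => //; lra.
rewrite mulrA -exprMn -natrM (_ : (259 * d = 3 * d + 256 * d)%N); last by rewrite -mulnDl.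
rewrite exprD mulrA exprM -exprMn.
have -> : (4 * 2)%:R * (1 / 2) ^+ 3 = 1 :> R by field.
by rewrite expr1n !mul1r.
Qed.

(** Let l be the supremum of all [ell N j], and choose m with [ell N m] >= l / 2.
    For mesh points y of the unit ball, the mean of N (y A) lies between
    |y| l / 4 and 2 l.  The exponential moments bound the probability of a
    deviation tau = l / 16 by e^(- tau^2 / (64 b^2)), where
    tau^2 / (64 b^2) >= k / 2^20 >= 259 d; so one matrix A is good for all mesh
    points, and [net_extend] gives l / 32 <= N (x A) <= 4 l on the unit
    sphere. *)
Theorem dvoretzky n d k (N : 'rV[R]_n -> R) (b : R) :
  seminorm N -> 0 < b -> (forall x, N x <= b * enorm x) -> (0 < k)%N -> (0 < d)%N ->
  259 * 2 ^+ 20 * d%:R <= k%:R :> R -> b * Num.sqrt k%:R / 8 <= ell N k ->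
  exists (A : 'M[R]_(d, n)) (a : R), 0 < a /\
    forall t, a * enorm t <= N (t *m A) <= 128 * a * enorm t.
Proof.
move=> sN b0 Nb k0 d0 dk hell.
pose D := [set ell N j | j in [set j | (0 < j)%N]]; pose l := sup D.
have hD : has_ubound D.
  by exists (b * (1 + n%:R)) => _ [j /= j0 <-]; apply: ell_bounded => //; apply: ltW.
have Dl j : (0 < j)%N -> ell N j <= l by move=> j0; apply: ub_le_sup => //; exists j.
have sk : 0 < Num.sqrt k%:R :> R by rewrite sqrtr_gt0 ltr0n.
have lk : b * Num.sqrt k%:R / 8 <= l by apply: le_trans hell _; apply: Dl.
have l0 : 0 < l by apply: lt_le_trans lk; rewrite divr_gt0// mulr_gt0.
have [m m0 ml] : exists2 m, (0 < m)%N & l / 2 <= ell N m.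
  have h : l / 2 < l by lra.
  have [|_ [m m0 <-] hm] := @sup_gt _ D (l / 2) _ h; first by exists (ell N k); exists k.
  by exists m => //; apply: ltW.
(* lam minimizes 16 (lam b)^2 - lam tau. *)
pose tau := l / 16; pose lam := tau / (32 * b ^+ 2).
have b2 : 0 < b ^+ 2 by rewrite exprn_gt0.
have tau0 : 0 < tau by rewrite divr_gt0.
have lam0 : 0 < lam by rewrite divr_gt0// mulr_gt0.
pose E := tau ^+ 2 / (64 * b ^+ 2).
have EE : 16 * (lam * b) ^+ 2 - lam * tau = - E.
  by rewrite /lam /E; field; rewrite gt_eqF.
have dE : 259 * d%:R <= E.
  rewrite /E ler_pdivlMr ?mulr_gt0//.
  have h : b ^+ 2 * k%:R / 64 <= l ^+ 2.
    have -> : b ^+ 2 * k%:R / 64 = (b * Num.sqrt k%:R / 8) ^+ 2.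
      by rewrite expr_div_n exprMn sqr_sqrtr ?ler0n//; congr (_ / _); rewrite -natrX.
    by rewrite ler_pXn2r ?nnegrE//; rewrite ltW// divr_gt0// mulr_gt0.
  have h2 : b ^+ 2 * (259 * 2 ^+ 20 * d%:R) <= b ^+ 2 * k%:R by rewrite ler_pM2l.
  have -> : tau ^+ 2 = l ^+ 2 / 256 by rewrite /tau; field.
  lra.
pose Phi (A : 'M[R]_(d, n)) := \sum_(z : mesh d | inball z) @weight R d z *
  (expR (lam * (N (@meshpt R d z *m A) - 2 * l)) +
   expR (lam * (enorm (@meshpt R d z) / 2 * ell N m - N (@meshpt R d z *m A)))).
pose sm := fam (nseq m (Num.sqrt m%:R)^-1) (mstd n d).
have rPhi : rademacher sm Phi <= expR (lam * tau) * (1 / 2) ^+ (256 * d).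
  rewrite rad_sum.
  apply: (@le_trans _ _ (\sum_(z : mesh d | inball z) @weight R d z * (2 * expR (16 * (lam * b) ^+ 2)))).
    apply: ler_sum => z zb; rewrite radZ radD; apply: ler_wpM2l; first exact/ltW/weight_gt0.
    have zb1 : enorm (@meshpt R d z) <= 1 by rewrite -inballE.
    rewrite /sm (rad_matrix _ _ (fun x => expR (lam * (N x - 2 * l)))).
    rewrite (rad_matrix _ _ (fun x => expR (lam * (enorm (@meshpt R d z) / 2 * ell N m - N x)))).
    rewrite [leRHS]mulr_natl [leRHS]mulr2n; apply: lerD.
      by apply: (mgf_upper sN Nb (ltW b0) m0 (ltW lam0) zb1); apply: mean_upper.
    by apply: (mgf_lower sN Nb (ltW b0) m0 (ltW lam0) zb1); apply: mean_lower.
  have -> : 16 * (lam * b) ^+ 2 = lam * tau - E by rewrite -EE; ring.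
  rewrite -mulr_suml expRD [2 * _]mulrCA [leLHS]mulrCA; apply: ler_wpM2l; first exact: expR_ge0.
  apply: le_trans (pow_bound d0 dE); apply: ler_wpM2r.
    by rewrite mulr_ge0 ?expR_ge0.
  apply: le_trans (@weight_sum R d); rewrite [leRHS](bigID (@inball d))/= lerDl.
  by apply: sumr_ge0 => z _; apply/ltW/weight_gt0.
have [A hA] := rad_exists sm Phi.
have {hA rPhi} PhiA := le_trans hA rPhi.
have term z : inball z -> expR (lam * (N (@meshpt R d z *m A) - 2 * l)) +
   expR (lam * (enorm (@meshpt R d z) / 2 * ell N m - N (@meshpt R d z *m A))) <= expR (lam * tau).
  move=> zb; have w0 := @weight_gt0 R d z; rewrite -(ler_pM2l w0).
  apply: (@le_trans _ _ (Phi A)).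
    rewrite /Phi (bigD1 z)//= lerDl; apply: sumr_ge0 => z' _.
    by rewrite mulr_ge0 ?addr_ge0 ?expR_ge0// ltW// weight_gt0.
  by apply: le_trans PhiA _; rewrite mulrC ler_wpM2r ?expR_ge0// weight_inball.
pose P (t : 'rV[R]_d) := N (t *m A).
have sP : seminorm P.
  split=> [x y|c x]; first by rewrite /P mulmxDl seminormD.
  by rewrite /P -scalemxAl seminormZ.
have hu z : inball z -> P (@meshpt R d z) <= 2 * l + tau.
  move=> zb; have h := term z zb.
  have : expR (lam * (N (@meshpt R d z *m A) - 2 * l)) <= expR (lam * tau).
    by apply: le_trans h; rewrite lerDl expR_ge0.
  by rewrite ler_expR ler_pM2l// /P; lra.
have hl z : inball z -> ell N m / 2 * enorm (@meshpt R d z) - tau <= P (@meshpt R d z).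
  move=> zb; have h := term z zb.
  have : expR (lam * (enorm (@meshpt R d z) / 2 * ell N m - N (@meshpt R d z *m A))) <= expR (lam * tau).
    by apply: le_trans h; rewrite lerDr expR_ge0.
  by rewrite ler_expR ler_pM2l// /P; lra.
have l20 : 0 <= ell N m / 2 by lra.
exists A, (l / 32); split; first by rewrite divr_gt0.
move=> t; have [->|tn0] := eqVneq t 0.
  by rewrite mul0mx (seminorm0 sN) (seminorm0 (enorm_seminorm d)) !mulr0 lexx.
have t0 : 0 < enorm t by rewrite lt_neqAle eq_sym enorm_eq0 tn0 enorm_ge0.
have ti : 0 < (enorm t)^-1 by rewrite invr_gt0.
have e1 : enorm ((enorm t)^-1 *: t) = 1 by rewrite enormZ gtr0_norm// mulVf// gt_eqF.
have [h1 h2] := net_extend d0 sP hu hl l20 e1.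
have tE : N (t *m A) = enorm t * P ((enorm t)^-1 *: t).
  by rewrite (seminormZ sP) gtr0_norm// mulrA divff ?mul1r// gt_eqF.
rewrite tE [_ * enorm t]mulrC [X in _ <= _ <= X]mulrC !ler_pM2l//.
move: h1 h2; move: (P _) => p; rewrite /tau => h1 h2; apply/andP; split; lra.
Qed.

End Dvoretzky.

(** * Quotient seminorms and iterated projection *)
Section QuotientNorm.
Context {R : realType} {V : vectType R}.
Variables (N : V -> R) (sN : seminorm N).
Implicit Types (W : {vspace V}) (x : V).

Definition quotN W x : R := inf [set N (x - w) | w in [set w | w \in W]].

Lemma quotN_lb W x : has_lbound [set N (x - w) | w in [set w | w \in W]].
Proof. by exists 0 => _ [w _ <-]; apply: seminorm_ge0. Qed.

Lemma quotN_le W x w : w \in W -> quotN W x <= N (x - w).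
Proof. by move=> Ww; apply: ge_inf; [exact: quotN_lb | exists w]. Qed.

Lemma le_quotN W x c : (forall w, w \in W -> c <= N (x - w)) -> c <= quotN W x.
Proof.
move=> h; apply: lb_le_inf; first by exists (N (x - 0)); exists 0 => //=; rewrite mem0v.
by move=> _ [w Ww <-]; apply: h.
Qed.

Lemma quotN_seminorm W : seminorm (quotN W).
Proof.
have Zle a x : quotN W (a *: x) <= `|a| * quotN W x.
  have [->|an0] := eqVneq a 0.
    rewrite scale0r normr0 mul0r; apply: le_trans (quotN_le _ (mem0v W)) _.
    by rewrite subr0 (seminorm0 sN).
  have a0 : 0 < `|a| by rewrite normr_gt0.
  rewrite -ler_pdivrMl//; apply: le_quotN => w Ww; rewrite ler_pdivrMl//.
  rewrite -(seminormZ sN) scalerBr; apply: quotN_le; exact: memvZ.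
split=> [x y|a x].
  rewrite -lerBlDr; apply: le_quotN => w Ww.
  rewrite lerBlDr -lerBlDl; apply: le_quotN => z Wz; rewrite lerBlDl.
  apply: le_trans (quotN_le _ (memvD Ww Wz)) _; rewrite opprD addrACA.
  exact: seminormD.
apply/le_anti/andP; split => //.
have [->|an0] := eqVneq a 0.
  by rewrite normr0 mul0r; apply: le_quotN => w _; apply: seminorm_ge0.
rewrite -[X in _ * quotN W X](scale1r x) -(mulVf an0) -scalerA.
rewrite -ler_pdivlMl ?normr_gt0// -normfV; exact: Zle.
Qed.

Lemma quotN_leN W x : quotN W x <= N x.
Proof. by have := quotN_le x (mem0v W); rewrite subr0. Qed.

Lemma quotN_sub U W x : (U <= W)%VS -> quotN W x <= quotN U x.
Proof. by move=> UW; apply: le_quotN => w Uw; apply/quotN_le/(subvP UW). Qed.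

Lemma quotN_eq0 W x : x \in W -> quotN W x = 0.
Proof.
move=> Wx; apply/le_anti/andP; split; last by apply: seminorm_ge0 (quotN_seminorm W) _.
by apply: le_trans (quotN_le _ Wx) _; rewrite subrr (seminorm0 sN).
Qed.

End QuotientNorm.

Section Iteration.
Context {R : realType} {n : nat}.
Implicit Types (N : 'rV[R]_n -> R).

Lemma exists_orthogonal (s : seq 'rV[R]_n) : (size s < n)%N ->
  exists2 x : 'rV[R]_n, x != 0 & forall a, a \in s -> dotr a x = 0.
Proof.
move=> sn; pose B : 'M[R]_(n, size s) := \matrix_(i, j) (nth 0 s j) 0 i.
have kn0 : kermx B != 0.
  by rewrite -mxrank_eq0 mxrank_ker subn_eq0 -ltnNge (leq_ltn_trans (rank_leq_col B)).
exists (nz_row (kermx B)); first by rewrite nz_row_eq0.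
move=> a /(nthP 0)[j js <-].
have /sub_kermxP /rowP /(_ (Ordinal js)) := nz_row_sub (kermx B).
by rewrite !mxE => <-; apply: eq_bigr => i _; rewrite mxE mulrC.
Qed.

(** By Pythagoras |x - w| >= |x| for all w in the span. *)
Lemma quotN_orthogonal N (g : R) (s : seq 'rV[R]_n) x : 0 <= g ->
  (forall y, g * enorm y <= N y) -> (forall a, a \in s -> dotr a x = 0) ->
  g * enorm x <= quotN N (span s) x.
Proof.
move=> g0 gN xs; apply: le_quotN => w ws; apply: le_trans (gN _); apply: ler_wpM2l => //.
have xw : dotr w x = 0.
  rewrite (@coord_span _ _ _ (in_tuple s) _ ws); elim/big_rec: _ => [|i y _ IH]; first exact: dotr0l.
  by rewrite dotrDl dotrZl IH xs ?mulr0 ?addr0// mem_nth.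
rewrite ler_sqrt ?dotr_ge0//.
rewrite dotrDl dotrNl ![dotr _ (x - w)]dotrC !dotrDl !dotrNl xw [dotr x w]dotrC xw.
by rewrite oppr0 add0r addr0 opprK lerDl dotr_ge0.
Qed.

(** As long as [dvoretzky] does not apply, [low_mstar] halves the upper bound at
    the cost of k more vectors to divide out.  After T steps the bound would be
    smaller than g, although a vector orthogonal to the k T < n chosen ones is
    left, on which the quotient seminorm is at least g|x|. *)
Theorem round_section_of_quotient N (g b : R) (T k d : nat) :
  seminorm N -> 0 < g -> (forall x, g * enorm x <= N x <= b * enorm x) ->
  b < g * 2 ^+ T -> (k * T < n)%N -> (0 < k)%N -> (0 < d)%N ->
  259 * 2 ^+ 20 * d%:R <= k%:R :> R ->
  exists (W : {vspace 'rV[R]_n}) (A : 'M[R]_(d, n)) (a : R), 0 < a /\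
    forall t, a * enorm t <= quotN N W (t *m A) <= 128 * a * enorm t.
Proof.
move=> sN g0 gNb bT kTn k0 d0 dk.
have gN x : g * enorm x <= N x by have /andP[] := gNb x.
have Nb x : N x <= b * enorm x by have /andP[] := gNb x.
apply: contrapT => nogoal.
have claim t : exists2 s : seq 'rV[R]_n, size s = (k * t)%N &
    forall x, quotN N (span s) x <= b / 2 ^+ t * enorm x.
  elim: t => [|t [s ss hs]].
    exists [::]; first by rewrite muln0.
    by move=> x; rewrite expr0 divr1; apply: le_trans (quotN_leN sN _ x) _.
  have sW := quotN_seminorm sN (span s).
  have b0 : 0 < b.
    have [x xn0 _] : exists2 x : 'rV[R]_n, x != 0 & forall a, a \in [::] -> dotr a x = 0.
      by apply: exists_orthogonal; apply: leq_ltn_trans kTn.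
    have x0 : 0 < enorm x by rewrite lt_neqAle eq_sym enorm_eq0 xn0 enorm_ge0.
    have := le_trans (gN x) (Nb x); rewrite ler_pM2r//; exact: lt_le_trans.
  set c := b / 2 ^+ t in hs.
  have c0 : 0 < c by rewrite divr_gt0// exprn_gt0.
  have sk : 0 < Num.sqrt k%:R :> R by rewrite sqrtr_gt0 ltr0n.
  have [hl|hl] := leP (c * Num.sqrt k%:R / 8) (ell (quotN N (span s)) k).
    exfalso; apply: nogoal; exists (span s); exact: dvoretzky hl.
  have [s' ss' hs'] := low_mstar sW k0.
  exists (s ++ s'); first by rewrite size_cat ss ss' mulnS addnC.
  move=> x; apply: le_trans (hs' (quotN N (span (s ++ s'))) _ _ _ x) _.
  - exact: quotN_seminorm.
  - by move=> y; apply: quotN_sub => //; rewrite span_cat addvSl.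
  - move=> a as'; apply: quotN_eq0 => //; apply: memv_span.
    by rewrite mem_cat as' orbT.
  apply: ler_wpM2r; first exact: enorm_ge0.
  rewrite ler_pdivrMr// exprS; have -> : b / (2 * 2 ^+ t) = c / 2.
    by rewrite /c invfM mulrCA mulrC.
  lra.
have [s ss hs] := claim T.
have [x xn0 xs] : exists2 x : 'rV[R]_n, x != 0 & forall a, a \in s -> dotr a x = 0.
  by apply: exists_orthogonal; rewrite ss.
have x0 : 0 < enorm x by rewrite lt_neqAle eq_sym enorm_eq0 xn0 enorm_ge0.
have := le_trans (quotN_orthogonal (ltW g0) gN xs) (hs x).
by rewrite ler_pM2r// ler_pdivlMr ?exprn_gt0// leNgt bT.
Qed.

End Iteration.

(** * A first Euclidean structure *)
Section Position.
Context {R : realType} {n : nat}.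
Variables (M : 'rV[R]_n -> R) (c C : R).
Hypotheses (sM : seminorm M) (c0 : 0 < c) (n0 : (0 < n)%N).
Hypothesis cMC : forall x, c * enorm x <= M x <= C * enorm x.

Lemma enorm_delta i : enorm (delta_mx 0 i : 'rV[R]_n) = 1.
Proof. by rewrite /enorm dotr_delta mxE !eqxx sqrtr1. Qed.

Lemma sum_abs_le_enorm (x : 'rV[R]_n) : \sum_i `|x 0 i| <= Num.sqrt n%:R * enorm x.
Proof.
pose a : 'rV[R]_n := \row_i `|x 0 i|; pose b : 'rV[R]_n := const_mx 1.
have -> : \sum_i `|x 0 i| = dotr b a.
  by apply: eq_bigr => i _; rewrite !mxE mul1r.
have -> : enorm x = enorm a.
  by congr Num.sqrt; apply: eq_bigr => i _; rewrite !mxE -!expr2 real_normK ?num_real.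
have -> : Num.sqrt n%:R = enorm b.
  rewrite /enorm /dotr (eq_bigr (fun=> 1)) ?sumr_const ?card_ord// => i _.
  by rewrite !mxE mulr1.
exact: cauchy_schwarz.
Qed.

Definition replace_row (B : 'M[R]_n) i (v : 'rV[R]_n) : 'M[R]_n :=
  \matrix_(a, j) if a == i then v 0 j else B a j.

Lemma det_replace_row (B : 'M[R]_n) i (y : 'rV[R]_n) :
  \det (replace_row B i (y *m B)) = y 0 i * \det B.
Proof.
rewrite (expand_det_row _ i).
transitivity ((y *m B *m \adj B) 0 i); last first.
  by rewrite -mulmxA mul_mx_adj mul_mx_scalar mxE mulrC.
rewrite [RHS]mxE; apply: eq_bigr => j _; rewrite [\adj B j i]mxE mxE eqxx; congr (_ * _).
rewrite /cofactor; congr (_ * \det _); apply/matrixP => a b.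
by rewrite !mxE eq_sym (negPf (neq_lift _ _)).
Qed.

(** The rows of B lie in the unit ball of M, and |det B| is within a factor 2 of
    the largest possible value.  By Cramer's rule the points of the unit ball
    have coordinates of absolute value at most 2 in this basis. *)
Lemma position : exists B : 'M[R]_n, B \in unitmx /\ exists2 g : R, 0 < g &
  forall x, g * enorm x <= M (x *m B) <= 2 * n%:R * g * enorm x.
Proof.
have cM x : c * enorm x <= M x by have /andP[] := cMC x.
have MC x : M x <= C * enorm x by have /andP[] := cMC x.
have C0 : 0 < C.
  have := le_trans (cM (delta_mx 0 (Ordinal n0))) (MC _).
  by rewrite enorm_delta !mulr1; apply: lt_le_trans.
pose G : set 'M[R]_n := [set B | forall i, M (row i B) <= 1].
pose D := [set `|\det B| | B in G]; pose S := sup D.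
have hD : has_ubound D.
  exists (\sum_(s : 'S_n) (c^-1) ^+ n) => _ [B GB <-].
  rewrite /determinant; apply: le_trans (ler_norm_sum _ _ _) _.
  apply: ler_sum => s _; rewrite normrM normr_sign mul1r normr_prod.
  rewrite -[X in _ ^+ X](card_ord n) -prodr_const; apply: ler_prod => i _.
  rewrite normr_ge0 /=; have -> : B i (s i) = row i B 0 (s i) by rewrite mxE.
  apply: (@le_trans _ _ (enorm (row i B))); first exact: coord_le_enorm.
  by rewrite -[_^-1]mul1r ler_pdivlMr// mulrC; apply: le_trans (cM _) (GB i).
have DS B : G B -> `|\det B| <= S by move=> GB; apply: ub_le_sup => //; exists B.
have S0 : 0 < S.
  have GB : G (C^-1)%:M.
    move=> i; have -> : row i (C^-1)%:M = C^-1 *: delta_mx 0 i.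
      by apply/rowP => j; rewrite !mxE eqxx eq_sym mulr_natr.
    apply: le_trans (MC _) _; rewrite enormZ enorm_delta mulr1.
    by rewrite gtr0_norm ?invr_gt0// mulfV// gt_eqF.
  apply: lt_le_trans (DS _ GB); rewrite det_scalar normr_gt0 expf_neq0//.
  by rewrite invr_eq0 gt_eqF.
have S2 : S / 2 < S by lra.
have D0 : D !=set0.
  exists `|\det (0 : 'M[R]_n)|; exists 0 => // i.
  by rewrite row0 (seminorm0 sM) ler01.
(* B is within a factor 2 of the supremum of the determinants. *)
have [_ [B GB <-] hB] := sup_gt D0 S2.
have detB : 0 < `|\det B| by lra.
have uB : B \in unitmx by rewrite unitmxE unitfE -normr_gt0.
have sn : 0 < Num.sqrt n%:R :> R by rewrite sqrtr_gt0 ltr0n.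
have unit_coord (y : 'rV[R]_n) i : M (y *m B) <= 1 -> `|y 0 i| <= 2.
  move=> My; have GBi : G (replace_row B i (y *m B)).
    move=> a; have [->|ai] := eqVneq a i.
      have -> : row i (replace_row B i (y *m B)) = y *m B.
        by apply/rowP => j; rewrite [LHS]mxE [LHS]mxE eqxx.
      exact: My.
    have -> : row a (replace_row B i (y *m B)) = row a B.
      by apply/rowP => j; rewrite [LHS]mxE [LHS]mxE (negPf ai) mxE.
    exact: GB.
  have := DS _ GBi; rewrite det_replace_row normrM => h.
  rewrite -(ler_pM2r detB); lra.
exists B; split => //; exists (2 * Num.sqrt n%:R)^-1; first by rewrite invr_gt0 mulr_gt0.
move=> x; apply/andP; split.
  have [->|xn0] := eqVneq x 0.
    by rewrite mul0mx (seminorm0 (enorm_seminorm n)) (seminorm0 sM) mulr0.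
  have vn0 : x *m B != 0.
    by apply: contra xn0 => /eqP h; rewrite -[x](mulmxK uB) h mul0mx.
  have Mv : 0 < M (x *m B).
    apply: lt_le_trans (cM _); rewrite mulr_gt0// lt_neqAle eq_sym enorm_eq0 vn0.
    exact: enorm_ge0.
  rewrite ler_pdivrMl ?mulr_gt0//.
  pose t := (M (x *m B))^-1; have t0 : 0 < t by rewrite invr_gt0.
  have h1 : M (t *: x *m B) <= 1.
    by rewrite -scalemxAl (seminormZ sM) gtr0_norm// mulVf// gt_eqF.
  have := enorm_le_coord (ler0n R 2) (fun i => unit_coord (t *: x) i h1).
  by rewrite enormZ gtr0_norm// ler_pdivrMl// mulrC [Num.sqrt _ * 2]mulrC.
have -> : 2 * n%:R * (2 * Num.sqrt n%:R)^-1 = Num.sqrt n%:R :> R.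
  by rewrite invfM mulrACA mulfV// mul1r -{1}(sqr_sqrtr (ler0n R n)) expr2 mulfK// gt_eqF.
apply: le_trans (sum_abs_le_enorm x).
rewrite mulmx_sum_row; apply: le_trans (seminorm_sum sM _ _ _) _.
apply: ler_sum => i _; rewrite (seminormZ sM); exact: ler_piMr.
Qed.

End Position.

(** * Euclidean structures and topology of coordinate spaces *)
Section DotPullback.
Context {R : realType} {X : lmodType R} {d : nat}.
Variables (T : {linear X -> 'rV[R]_d}) (c : R).
Hypotheses (Tinj : injective T) (c0 : 0 < c).

Lemma exists_dot : exists f : {dot X for idfun}, forall u v, f u v = c * dotr (T u) (T v).
Proof.
pose op (u v : X) : R := c * dotr (T u) (T v).
have opC u v : op u v = op v u by rewrite /op dotrC.
have opDl (v : X) : zmod_morphism (op^~ v).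
  by move=> x y; rewrite /op linearB dotrDl dotrNl mulrBr.
have opZl (v : X) : scalable_for *%R (op^~ v).
  by move=> a x; rewrite /op linearZ dotrZl mulrCA.
have opDr (u : X) : zmod_morphism (op u).
  by move=> x y; rewrite ![op u _]opC opDl.
have opZr (u : X) : scalable_for (idfun \; *%R) (op u).
  by move=> a x; rewrite ![op u _]opC opZl.
have opH (x y : X) : op x y = (-1) ^+ false * idfun (op y x).
  by rewrite expr0 mul1r opC.
have op0 (u : X) : u != 0 -> 0 < op u u.
  move=> un0; rewrite /op mulr_gt0// lt_neqAle dotr_ge0 andbT eq_sym.
  have : T u != 0 by apply: contra un0 => /eqP h; apply/eqP/Tinj; rewrite h linear0.
  by rewrite -enorm_eq0 -enorm_sqr sqrf_eq0.
pose m1 := isBilinear.Build R X X R *%R (idfun \; *%R) op opDl opDr opZl opZr.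
pose m2 := isHermitianSesquilinear.Build R X false idfun op opH.
pose m3 := isDotProduct.Build R X op op0.
pose f : {dot X for idfun} := HB.pack_for {dot X for idfun} op m1 m2 m3.
by exists f.
Qed.

End DotPullback.

Section Topology.
Context {R : realType}.

Lemma coord_le_mxnorm n (x : 'rV[R]_n) i : `|x 0 i| <= `|x|.
Proof.
rewrite [leRHS]/Num.norm/= mx_normrE; apply/bigmax_geP; right => /=.
by exists (0, i).
Qed.

Lemma mxnorm_le n (x : 'rV[R]_n) c : 0 <= c -> (forall i, `|x 0 i| <= c) -> `|x| <= c.
Proof.
move=> c0 h; rewrite [leLHS]/Num.norm/= mx_normrE; apply/bigmax_leP; split => //= -[i j] _ /=.
by rewrite ord1.
Qed.

Lemma mxnorm_le_enorm n (x : 'rV[R]_n) : `|x| <= enorm x.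
Proof. by apply: mxnorm_le; [exact: enorm_ge0 | exact: coord_le_enorm]. Qed.

Lemma enorm_le_mxnorm n (x : 'rV[R]_n) : enorm x <= Num.sqrt n%:R * `|x|.
Proof. by apply: enorm_le_coord => //; exact: coord_le_mxnorm. Qed.

Lemma linear_enorm_bound n d (L : {linear 'rV[R]_n -> 'rV[R]_d}) :
  exists2 c, 0 < c & forall x, enorm (L x) <= c * enorm x.
Proof.
exists (1 + \sum_i enorm (L (delta_mx 0 i))).
  by rewrite ltr_pwDl//; apply: sumr_ge0 => i _; apply: enorm_ge0.
move=> x; rewrite {1}(stdb_sum x) linear_sum.
apply: le_trans (seminorm_sum (enorm_seminorm d) _ _ _) _.
rewrite mulrDl mul1r mulr_suml; apply: le_trans (_ : \sum_(i < n) enorm (L (delta_mx 0 i)) * enorm x <= _).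
  apply: ler_sum => i _; rewrite linearZ enormZ mulrC.
  by apply: ler_wpM2l; [exact: enorm_ge0 | exact: coord_le_enorm].
by rewrite lerDr enorm_ge0.
Qed.

Lemma lipschitz_continuous (U W : normedModType R) (f : U -> W) (c : R) :
  0 < c -> (forall x y, `|f x - f y| <= c * `|x - y|) -> continuous f.
Proof.
move=> c0 fc x; apply/cvgrPdist_le => e e0; near=> y.
apply: le_trans (fc x y) _; rewrite -ler_pdivlMl//; near: y.
by apply: cvgr_dist_le => //; rewrite mulr_gt0// invr_gt0.
Unshelve. all: by end_near. Qed.

Lemma sqrtn1_gt0 n : 0 < Num.sqrt n%:R + 1 :> R.
Proof. by rewrite ltr_wpDl ?sqrtr_ge0. Qed.

Lemma enorm_le_mxnorm1 n (x : 'rV[R]_n) : enorm x <= (Num.sqrt n%:R + 1) * `|x|.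
Proof.
apply: le_trans (enorm_le_mxnorm x) _.
by apply: ler_wpM2r; [exact: normr_ge0 | rewrite lerDl].
Qed.

Lemma linear_rV_continuous n d (L : {linear 'rV[R]_n -> 'rV[R]_d}) : continuous L.
Proof.
have [c c0 Lc] := linear_enorm_bound L.
apply: (@lipschitz_continuous _ _ L (c * (Num.sqrt n%:R + 1))).
  by rewrite mulr_gt0// sqrtn1_gt0.
move=> x y; rewrite -linearB; apply: le_trans (mxnorm_le_enorm _) _.
apply: le_trans (Lc _) _; rewrite -mulrA; apply: ler_wpM2l; first exact: ltW.
exact: enorm_le_mxnorm1.
Qed.

Lemma enorm_continuous n : continuous (@enorm R n).
Proof.
apply: (@lipschitz_continuous _ R (@enorm R n) _ (sqrtn1_gt0 n)) => x y.
apply: le_trans (enorm_le_mxnorm1 _).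
rewrite ler_norml (seminormB (enorm_seminorm n)) andbT lerNl opprB.
by rewrite -[leRHS](seminormN (enorm_seminorm n)) opprB (seminormB (enorm_seminorm n)).
Qed.

Lemma enorm_ball_compact n (r : R) : compact [set x : 'rV[R]_n | enorm x <= r].
Proof.
apply: bounded_closed_compact.
  exists r; split; first exact: num_real.
  move=> M rM x /= xr; apply: le_trans (mxnorm_le_enorm x) _.
  by apply: le_trans xr _; apply: ltW.
have -> : [set x : 'rV[R]_n | enorm x <= r] = @enorm R n @^-1` [set t | t <= r] by [].
exact: (continuous_closedP _).1 (@enorm_continuous n) _ (@closed_le R r).
Qed.

Lemma interior_enorm n (A : set 'rV[R]_n) (r : R) :
  0 < r -> (forall x, enorm x <= r -> A x) -> A° 0.
Proof.
move=> r0 h; rewrite /interior; apply/nbhs_ballP.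
have k0 := sqrtn1_gt0 n.
exists (r / (Num.sqrt n%:R + 1)); first by rewrite /= divr_gt0.
move=> x; rewrite -ball_normE /= sub0r normrN => /ltW xr; apply: h.
apply: le_trans (enorm_le_mxnorm1 x) _.
by rewrite -ler_pdivlMl// mulrC.
Qed.

End Topology.

(** * The norm of a ball *)
Section Gauge.
Context {R : realType} {V : vectType R}.
Implicit Types (K : set V) (v : V).

Lemma convex_setP K : convex_set (K : set (convex_lmodType V)) <->
  forall t x y, 0 <= t <= 1 -> K x -> K y -> K (t *: x + (1 - t) *: y).
Proof.
split=> [cK t x y /andP[t0 t1] Kx Ky|h x y l xK yK].
  have := cK x y (Itv01 t0 t1) (mem_set Kx) (mem_set Ky).
  by rewrite inE.
apply/mem_set; move: xK yK; rewrite !inE => xK yK.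
by apply: (h (l%:num)) => //; apply/andP; split.
Qed.

Lemma symmetricP K : [set - x | x in K] = K <-> forall x, K x -> K (- x).
Proof.
split=> [h x Kx|h]; first by rewrite -h; exists x.
apply/seteqP; split=> [_ [x Kx <-]|x Kx]; first exact: h.
by exists (- x); [exact: h | rewrite opprK].
Qed.

Section BallGauge.
Variable K : set V.
Hypothesis ballK : is_banach_ball K.

Let cK t x y : 0 <= t <= 1 -> K x -> K y -> K (t *: x + (1 - t) *: y).
Proof. by case: ballK => _ /convex_setP h _ _; apply: h. Qed.

Let sK x : K x -> K (- x).
Proof. by case: ballK => _ _ _ /symmetricP; apply. Qed.

(** If z0 is an interior point of K, then so is - z0, and their midpoint is 0. *)
Lemma ball_inner : exists2 r : R, 0 < r & forall v, enorm (v2r v) <= r -> K v.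
Proof.
case: ballK => _ _ [z0 /nbhs_ballP[e /= e0 he]] _.
have hK z : `|z| < e -> K (r2v (z0 + z)).
  move=> ze; have [|x Kx xE] := he (z0 + z).
    by rewrite -ball_normE /= opprD addrA subrr sub0r normrN.
  by rewrite -xE v2rK.
exists (e / 2); first by rewrite divr_gt0.
move=> v hv; have ve : `|v2r v| < e.
  by apply: le_lt_trans (mxnorm_le_enorm _) _; apply: le_lt_trans hv _; lra.
have h1 := hK _ ve.
have h2 : K (- r2v (z0 - v2r v)) by apply/sK/hK; rewrite normrN.
have half : 0 <= (2^-1 : R) <= 1 by lra.
have := cK half h1 h2.
have -> : 1 - 2^-1 = 2^-1 :> R by field.
rewrite linearD linearB/= v2rK opprB -scalerDr addrC addrA subrK -mulr2n.
by rewrite -(scaler_nat 2 v) scalerA mulVf ?scale1r// pnatr_eq0.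
Qed.

Lemma ball_outer : exists2 C : R, 0 < C & forall v, K v -> enorm (v2r v) <= C.
Proof.
case: ballK => /compact_bounded[M [_ hM]] _ _ _.
have s1 := sqrtn1_gt0 (R := R) (dim V).
exists ((Num.sqrt (dim V)%:R + 1) * (`|M| + 1)).
  by rewrite mulr_gt0// ltr_wpDl.
move=> v Kv; apply: le_trans (enorm_le_mxnorm1 _) _; rewrite ler_pM2l//.
apply: (hM (`|M| + 1)); last by exists v.
by apply: le_lt_trans (ler_norm M) _; rewrite ltrDl.
Qed.

Lemma gauge_le t x : 0 <= t -> K x -> ball_norm K (t *: x) <= t.
Proof.
move=> t0 Kx; apply: ge_inf; first by exists 0 => s [].
by split => //; exists x.
Qed.

(** The inner ball makes the set of admissible factors nonempty, without which
    the infimum would carry no information. *)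
Lemma gauge_lower v c : (forall t x, 0 <= t -> K x -> v = t *: x -> c <= t) ->
  c <= ball_norm K v.
Proof.
move=> h; have [r r0 hr] := ball_inner.
apply: lb_le_inf => [|t [t0 [x Kx xE]]]; last exact: (h t x).
pose s := enorm (v2r v) / r; have s0 : 0 <= s by rewrite divr_ge0 ?enorm_ge0// ltW.
have [vz|vn0] := eqVneq v 0.
  exists 0; split => //; exists 0; first by apply: hr; rewrite linear0 (seminorm0 (enorm_seminorm _)) ltW.
  by rewrite vz scaler0.
have nv : 0 < enorm (v2r v).
  rewrite lt_neqAle eq_sym enorm_eq0 enorm_ge0 andbT.
  by apply: contra vn0 => /eqP h0; rewrite -[v]v2rK h0 linear0.
exists s; split => //; exists (s^-1 *: v).
  apply: hr; rewrite linearZ enormZ /s invf_div ger0_norm ?divfK ?gt_eqF//.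
  by rewrite divr_ge0// ltW.
by rewrite scalerA mulfV ?scale1r// gt_eqF// divr_gt0.
Qed.

Lemma gauge_lt v t : ball_norm K v < t -> K (t^-1 *: v).
Proof.
move=> h; have [r r0 hr] := ball_inner.
have K0 : K 0 by apply: hr; rewrite linear0 (seminorm0 (enorm_seminorm _)) ltW.
have t0 : 0 < t by apply: le_lt_trans h; apply: gauge_lower => s x.
have [s [s0 [x Kx <-]] st] : exists2 s, 0 <= s /\ [set s *: x | x in K] v & s < t.
  apply: contrapT => no; move: h; apply/negP; rewrite -leNgt.
  apply: gauge_lower => s x s0 Kx vE; rewrite leNgt; apply/negP => st.
  by apply: no; exists s => //; split => //; exists x.
have st1 : 0 <= t^-1 * s <= 1.
  rewrite mulr_ge0 ?invr_ge0 ?(ltW t0)//= mulrC ler_pdivrMr// mul1r; exact: ltW.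
by have := cK st1 Kx K0; rewrite scaler0 addr0 scalerA.
Qed.

Lemma gauge_seminorm : seminorm (ball_norm K).
Proof.
have ge0 v : 0 <= ball_norm K v by apply: gauge_lower => t x.
have [r r0 hr] := ball_inner.
have K0 : K 0 by apply: hr; rewrite linear0 (seminorm0 (enorm_seminorm _)) ltW.
have z0 : ball_norm K 0 = 0.
  by apply/le_anti; rewrite ge0 andbT -{1}(scale0r (0 : V)) gauge_le.
have Zle a v : ball_norm K (a *: v) <= `|a| * ball_norm K v.
  have [->|an0] := eqVneq a 0; first by rewrite scale0r z0 normr0 mul0r.
  have a0 : 0 < `|a| by rewrite normr_gt0.
  rewrite -ler_pdivrMl//; apply: gauge_lower => t x t0 Kx ->.
  rewrite ler_pdivrMl// scalerA.
  have [a1|a1] := leP 0 a.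
    by apply: le_trans (gauge_le _ Kx) _; rewrite ?mulr_ge0// (ger0_norm a1).
  have -> : (a * t) *: x = (`|a| * t) *: (- x).
    by rewrite (ltr0_norm a1) scalerN mulNr scaleNr opprK.
  by apply: gauge_le; [rewrite mulr_ge0 | exact: sK].
split=> [x y|a v].
  apply/ler_addgt0Pr => e e0.
  pose s := ball_norm K x + e / 2; pose t := ball_norm K y + e / 2.
  have s0 : 0 < s by rewrite ltr_wpDl// divr_gt0.
  have t0 : 0 < t by rewrite ltr_wpDl// divr_gt0.
  have hs : K (s^-1 *: x) by apply: gauge_lt; rewrite ltrDl divr_gt0.
  have ht : K (t^-1 *: y) by apply: gauge_lt; rewrite ltrDl divr_gt0.
  have st0 : 0 < s + t by rewrite addr_gt0.
  have -> : ball_norm K x + ball_norm K y + e = s + t by rewrite /s /t; field.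
  have l01 : 0 <= s / (s + t) <= 1.
    apply/andP; split; first by apply: divr_ge0; apply: ltW.
    by rewrite ler_pdivrMr// mul1r lerDl ltW.
  have := gauge_le (ltW st0) (cK l01 hs ht); rewrite scalerDr !scalerA.
  have -> : (s + t) * (s / (s + t)) / s = 1 by field; rewrite !gt_eqF.
  have -> : (s + t) * (1 - s / (s + t)) / t = 1 by field; rewrite !gt_eqF.
  by rewrite !scale1r.
apply/le_anti; rewrite Zle /=.
have [->|an0] := eqVneq a 0; first by rewrite normr0 mul0r ge0.
rewrite -{1}[v](scale1r v) -(mulVf an0) -scalerA -ler_pdivlMl ?normr_gt0// -normfV.
exact: Zle.
Qed.

Lemma gauge_bounds : exists c C : R, 0 < c /\
  forall v, c * enorm (v2r v) <= ball_norm K v <= C * enorm (v2r v).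
Proof.
have [r r0 hr] := ball_inner; have [C C0 hC] := ball_outer.
have K0 : K 0 by apply: hr; rewrite linear0 (seminorm0 (enorm_seminorm _)) ltW.
exists C^-1, r^-1; split; first by rewrite invr_gt0.
move=> v; apply/andP; split.
  apply: gauge_lower => t x t0 Kx ->; rewrite linearZ enormZ ger0_norm//.
  by rewrite ler_pdivrMl// [C * t]mulrC ler_wpM2l// hC.
have [->|vn0] := eqVneq v 0.
  rewrite linear0 (seminorm0 (enorm_seminorm _)) mulr0.
  by rewrite (seminorm0 gauge_seminorm).
have nv : 0 < enorm (v2r v).
  rewrite lt_neqAle eq_sym enorm_eq0 enorm_ge0 andbT.
  by apply: contra vn0 => /eqP h0; rewrite -[v]v2rK h0 linear0.
have s0 : 0 < r^-1 * enorm (v2r v) by rewrite mulr_gt0// invr_gt0.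
rewrite -{1}[v](scale1r v) -(mulfV (lt0r_neq0 s0)) -scalerA.
apply: gauge_le; first exact: ltW.
apply: hr; rewrite linearZ enormZ invfM invrK gtr0_norm ?mulr_gt0 ?invr_gt0//.
by rewrite divfK// gt_eqF.
Qed.

End BallGauge.
End Gauge.

(** * Round subquotients *)
Section Coordinates.
Context {R : realType} {X : vectType R} {d : nat}.
Variables (T : {linear X -> 'rV[R]_d}) (h : {linear 'rV[R]_d -> X}).
Hypotheses (TK : cancel T h) (hK : cancel h T).

Lemma ball_of_coords (B : set X) (r s : R) : 0 < r -> closed (v2r @` B) ->
  convex_set (B : set (convex_lmodType X)) -> [set - x | x in B] = B ->
  (forall u, enorm (T u) <= r -> B u) -> (forall u, B u -> enorm (T u) <= s) ->
  is_banach_ball B.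
Proof.
move=> r0 clB cB sB inB outB; split => //.
  have cpt : compact ((v2r \o h) @` [set t : 'rV[R]_d | enorm t <= s]).
    apply: continuous_compact; last exact: enorm_ball_compact.
    by apply: continuous_subspaceT; exact: (linear_rV_continuous (L := v2r \o h)).
  apply: subclosed_compact clB cpt _ => _ [u Bu <-]; exists (T u) => /=; first exact: outB.
  by rewrite TK.
have [c c0 hc] := linear_enorm_bound (T \o r2v : {linear _ -> _}).
exists 0; apply: (@interior_enorm _ _ _ (r / c)); first by rewrite divr_gt0.
move=> z hz; exists (r2v z); last by rewrite r2vK.
apply: inB; apply: le_trans (hc z) _; by rewrite mulrC -ler_pdivlMr.
Qed.

(** The witness is the ellipsoid |T u| <= r, whose norm is |T u| / r. *)
Lemma round_of_coords (B : set X) (r s : R) : 0 < r -> closed (v2r @` B) ->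
  convex_set (B : set (convex_lmodType X)) -> [set - x | x in B] = B ->
  0 < s -> (forall u, enorm (T u) <= r -> B u) -> (forall u, B u -> enorm (T u) <= s * r) ->
  is_round s B.
Proof.
move=> r0 clB cB sB s0 inB outB; split; first exact: (@ball_of_coords B r (s * r)).
pose E : set X := [set u | enorm (T u) <= r].
have ballE : is_banach_ball E.
  apply: (@ball_of_coords E r r) => //.
  - have -> : v2r @` E = (fun z => enorm ((T \o r2v) z)) @^-1` [set t | t <= r].
      apply/seteqP; split=> [_ [u Eu <-]|z Ez]; first by rewrite /= v2rK.
      by exists (r2v z) => //; rewrite r2vK.
    apply: (continuous_closedP _).1; last exact: closed_le.
    move=> z; apply: continuous_comp; first exact: (linear_rV_continuous (L := T \o r2v)).
    exact: enorm_continuous.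
  - apply/convex_setP => t x y t01 Ex Ey; rewrite /E /= linearD !linearZ /=.
    rewrite /E /= in Ex Ey; case/andP: t01 => t0 t1; have t1' : 0 <= 1 - t by rewrite subr_ge0.
    apply: le_trans (seminormD (enorm_seminorm d) _ _) _; rewrite !enormZ !ger0_norm//.
    by have := lerD (ler_wpM2l t0 Ex) (ler_wpM2l t1' Ey); rewrite -[leRHS]mulrDl [t + _]addrC subrK mul1r.
  - apply/symmetricP => x; rewrite /E /= linearN; by rewrite (seminormN (enorm_seminorm d)).
exists E; split => //.
- split=> //.
  have ri : 0 < (r ^+ 2)^-1 by rewrite invr_gt0 exprn_gt0.
  have [f fE] := exists_dot (can_inj TK) ri.
  exists f => v; rewrite fE -enorm_sqr -exprVn -exprMn sqrtr_sqr ger0_norm; last first.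
    by rewrite mulr_ge0 ?enorm_ge0// invr_ge0 ltW.
  apply/le_anti/andP; split; last first.
    apply: gauge_lower => // t x t0 Ex ->.
    rewrite linearZ enormZ ger0_norm// ler_pdivrMl// [leRHS]mulrC ler_wpM2l//.
  have [Tv0|Tvn0] := eqVneq (T v) 0.
    have -> : v = 0 by apply: (can_inj TK); rewrite Tv0 linear0.
    rewrite linear0 (seminorm0 (enorm_seminorm d)) mulr0 -{1}(scale0r (0 : X)).
    by apply: gauge_le => //; rewrite /E /= linear0 (seminorm0 (enorm_seminorm d)) ltW.
  have nv : 0 < enorm (T v) by rewrite lt_neqAle eq_sym enorm_eq0 Tvn0 enorm_ge0.
  have t0 : 0 < r^-1 * enorm (T v) by rewrite mulr_gt0// invr_gt0.
  rewrite -{1}[v](scale1r v) -(mulfV (lt0r_neq0 t0)) -scalerA.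
  apply: gauge_le; first exact: ltW.
  rewrite /E /= linearZ enormZ invfM invrK gtr0_norm ?mulr_gt0 ?invr_gt0//.
  by rewrite divfK// gt_eqF.
- move=> u Bu; exists (s^-1 *: u); last by rewrite scalerA mulfV ?scale1r// gt_eqF.
  by rewrite /E /= linearZ enormZ gtr0_norm ?invr_gt0// ler_pdivrMl// outB.
Qed.

End Coordinates.

Section Subquotient.
Context {R : realType} {V : vectType R}.
Variable K : set V.
Hypothesis ballK : is_banach_ball K.

Lemma subquotient_convex (W : {vspace V}) (U : {vspace quotv W}) :
  convex_set (subquotient U K : set (convex_lmodType (subvs_of U))).
Proof.
case: ballK => _ /convex_setP cK _ _; apply/convex_setP => t x y t01 [v Kv vx] [w Kw wy].
exists (t *: v + (1 - t) *: w); first exact: cK.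
by rewrite linearD !linearZ /= vx wy.
Qed.

Lemma subquotient_symmetric (W : {vspace V}) (U : {vspace quotv W}) :
  [set - x | x in subquotient U K] = subquotient U K.
Proof.
case: ballK => _ _ _ /symmetricP sK; apply/symmetricP => x [v Kv vx].
by exists (- v); [exact: sK | rewrite linearN /= vx].
Qed.

(** In coordinates the subquotient is the preimage of a linear image of a
    compact set. *)
Lemma subquotient_closed (W : {vspace V}) (U : {vspace quotv W}) :
  closed (v2r @` subquotient U K).
Proof.
pose P : {linear 'rV[R]_(dim V) -> 'rV[R]_(dim (quotv W))} := v2r \o (quotv_pi W \o r2v).
pose L : {linear 'rV[R]_(dim (subvs_of U)) -> 'rV[R]_(dim (quotv W))} :=
  v2r \o ((@vsval R (quotv W) U : {linear subvs_of U -> quotv W}) \o r2v).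
have -> : v2r @` subquotient U K = L @^-1` (P @` (v2r @` K)).
  apply/seteqP; split=> [_ [u [v Kv vu] <-]|z [_ [v Kv <-]] /=].
    by exists (v2r v); [exists v | rewrite /= !v2rK vu].
  rewrite v2rK => /(can_inj v2rK) vz; exists (r2v z); last by rewrite r2vK.
  by exists v.
apply: (continuous_closedP _).1; first exact: linear_rV_continuous.
apply: compact_closed; first exact: norm_hausdorff.
apply: continuous_compact; last by case: ballK.
by apply: continuous_subspaceT; exact: linear_rV_continuous.
Qed.

Lemma subquotient_round (W : {vspace V}) d (psi : {linear 'rV[R]_d -> quotv W}) (a s : R) :
  0 < a -> 0 < s -> injective psi ->
  (forall t v, K v -> quotv_pi W v = psi t -> a * enorm t <= 1) ->
  (forall t, s * a * enorm t <= 1 -> exists2 v, K v & quotv_pi W v = psi t) ->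
  exists U : {vspace quotv W}, is_round s (subquotient U K) /\ \dim U = d.
Proof.
move=> a0 s0 injpsi outK inK.
pose f := linfun psi; pose U := limg f.
have fE t : f t = psi t by rewrite lfunE.
have kf : lker f == 0%VS.
  by apply/lker0P => x y; rewrite !fE; apply: injpsi.
have Uf t : psi t \in U by rewrite -fE memv_img// memvf.
pose T : {linear subvs_of U -> 'rV[R]_d} := (f^-1)%VF \o @vsval R (quotv W) U.
pose h : {linear 'rV[R]_d -> subvs_of U} := vsproj U \o psi.
have psiT u : psi (T u) = vsval u.
  by rewrite -fE /T /= limg_lfunVK// subvsP.
have TK : cancel T h.
  by move=> u; apply: val_inj; rewrite /h /= vsprojK// psiT.
have hK : cancel h T.
  by move=> t; rewrite /T /h /= vsprojK// -fE lker0_lfunK.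
exists U; split; last first.
  by rewrite /U limg_dim_eq ?(eqP kf) ?capv0// dimvf /dim /= mul1n.
apply: (@round_of_coords _ _ _ T h TK (subquotient U K) (s * a)^-1 s).
- by rewrite invr_gt0 mulr_gt0.
- exact: subquotient_closed.
- exact: subquotient_convex.
- exact: subquotient_symmetric.
- exact: s0.
- move=> u Tu; have [|v Kv vE] := inK (T u).
    by rewrite mulrC -ler_pdivlMr ?mulr_gt0// div1r.
  by exists v; rewrite ?vE ?psiT.
- move=> u [v Kv vu]; have := outK (T u) v Kv; rewrite psiT => /(_ vu).
  by rewrite invfM mulrA mulfV ?gt_eqF// mul1r -[a^-1]mulr1 ler_pdivlMl.
Qed.

(** A point x of K satisfies N x <= 1, hence a|t| <= 1 for its image.  Conversely
    256 a|t| <= 1 makes the quotient seminorm at most 1 / 2, so that the coset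
    contains a point of norm less than 1, which lies in K. *)
Lemma subquotient_of_coords n d (phi : {linear 'rV[R]_n -> V}) (W : {vspace 'rV[R]_n})
    (A : 'M[R]_(d, n)) (a : R) : injective phi -> 0 < a ->
  (forall t, a * enorm t <= quotN (ball_norm K \o phi) W (t *m A) <= 128 * a * enorm t) ->
  exists (W' : {vspace V}) (U : {vspace quotv W'}),
    is_round 256 (subquotient U K) /\ \dim U = d.
Proof.
move=> injphi a0 hA.
have sK := gauge_seminorm ballK.
have sN : seminorm (ball_norm K \o phi).
  split=> [x y|c x] /=; first by rewrite linearD seminormD.
  by rewrite linearZ seminormZ.
pose f := linfun phi; pose W' := (f @: W)%VS.
have fE x : f x = phi x by rewrite lfunE.
have WW' x : x \in W -> phi x \in W' by move=> xW; rewrite -fE memv_img.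
have W'W v : v \in W' -> exists2 x, x \in W & v = phi x.
  by move=> /memv_imgP[x xW ->]; exists x; rewrite ?fE.
pose psi : {linear 'rV[R]_d -> quotv W'} := quotv_pi W' \o (phi \o mulmxr A).
have psiE t : psi t = quotv_pi W' (phi (t *m A)) by [].
exists W'; apply: (@subquotient_round W' d psi a 256 a0); first by rewrite ltr0n.
- apply: raddf_inj => t t0; have /eqP : quotv_pi W' (phi (t *m A)) = 0 := t0.
  rewrite quotv_pi_eq0 => /W'W[x xW] /injphi tx.
  have /andP[h _] := hA t; move: h; rewrite tx (quotN_eq0 sN xW) => h.
  apply/eqP; rewrite -enorm_eq0; apply/eqP/le_anti; rewrite enorm_ge0 andbT.
  by move: h; rewrite pmulr_rle0.
- move=> t v Kv /eqP; rewrite psiE quotv_pi_eq => /W'W[w wW] /eqP.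
  rewrite subr_eq => /eqP vE; have /andP[h _] := hA t; apply: le_trans h _.
  apply: le_trans (quotN_le sN _ (_ : - w \in W)) _; first by rewrite rpredN.
  rewrite opprK /= linearD addrC -vE -[v]scale1r.
  exact: (gauge_le ler01 Kv).
- move=> t ht; have /andP[_ h] := hA t.
  have [w wW hw] : exists2 w, w \in W & ball_norm K (phi (t *m A - w)) < 1.
    apply: contrapT => no; have : 1 <= quotN (ball_norm K \o phi) W (t *m A).
      apply: le_quotN => w wW; rewrite leNgt; apply/negP => hw; apply: no; by exists w.
    by move=> h1; have := le_trans h1 h; lra.
  exists (phi (t *m A - w)).
    by have := gauge_lt ballK hw; rewrite invr1 scale1r.
  apply/eqP; rewrite psiE quotv_pi_eq linearB addrAC subrr sub0r rpredN; exact: WW'.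
Qed.

(** Serves the small dimensions, for which the general construction gives
    dimension 0. *)
Lemma subquotient_line : (0 < dim V)%N ->
  exists (W : {vspace V}) (U : {vspace quotv W}),
    is_round 256 (subquotient U K) /\ \dim U = 1%N.
Proof.
move=> n0.
have sK := gauge_seminorm ballK.
pose phi : {linear 'rV[R]_(dim V) -> V} := r2v.
have sN : seminorm (ball_norm K \o phi).
  split=> [x y|c x] /=; first by rewrite linearD seminormD.
  by rewrite linearZ seminormZ.
pose A : 'M[R]_(1, dim V) := delta_mx 0 (Ordinal n0).
have [c [C [c0 hc]]] := gauge_bounds ballK.
pose a := ball_norm K (phi A).
have a0 : 0 < a.
  have /andP[+ _] := hc (phi A); rewrite r2vK enorm_delta mulr1.
  exact: lt_le_trans.
apply: (@subquotient_of_coords (dim V) 1 phi 0%VS A a) => //; first exact: (can_inj r2vK).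
move=> t.
have tA : t *m A = t 0 0 *: A.
  by rewrite [t in LHS]mx11_scalar mul_scalar_mx.
have et : enorm t = `|t 0 0| by rewrite /enorm /dotr big_ord1 -expr2 sqrtr_sqr.
have h : quotN (ball_norm K \o phi) 0%VS (t *m A) = a * enorm t.
  rewrite tA (seminormZ (quotN_seminorm sN _)) et mulrC; congr (_ * _).
  apply/le_anti; rewrite (quotN_leN sN)/=; apply: le_quotN => w.
  by rewrite memv0 => /eqP ->; rewrite subr0.
have := enorm_ge0 t; have : 0 <= a * enorm t by rewrite mulr_ge0 ?enorm_ge0// ltW.
by rewrite h lexx /= => h1 _; lra.
Qed.

Lemma subquotient_params (T k d : nat) : (0 < dim V)%N -> (2 * dim V < 2 ^ T)%N -> (k * T < dim V)%N ->
  (0 < k)%N -> (0 < d)%N -> 259 * 2 ^+ 20 * d%:R <= k%:R :> R ->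
  exists (W : {vspace V}) (U : {vspace quotv W}),
    is_round 256 (subquotient U K) /\ \dim U = d.
Proof.
move=> n0 nT kT k0 d0 dk.
have sK := gauge_seminorm ballK.
have [c [C [c0 hc]]] := gauge_bounds ballK.
pose r2 : {linear 'rV[R]_(dim V) -> V} := r2v.
have sM : seminorm (ball_norm K \o r2).
  split=> [x y|b x] /=; first by rewrite linearD seminormD.
  by rewrite linearZ seminormZ.
have hM x : c * enorm x <= (ball_norm K \o r2) x <= C * enorm x.
  by have := hc (r2 x); rewrite r2vK.
have [B [uB [g g0 hg]]] := position sM c0 n0 hM.
pose phi : {linear 'rV[R]_(dim V) -> V} := r2 \o mulmxr B.
have sN : seminorm (ball_norm K \o phi).
  split=> [x y|b x] /=; first by rewrite mulmxDl linearD seminormD.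
  by rewrite -scalemxAl linearZ seminormZ.
have bT : 2 * (dim V)%:R * g < g * 2 ^+ T.
  by rewrite mulrC ltr_pM2l// -natrM -natrX ltr_nat.
have [W [A [a [a0 hA]]]] := round_section_of_quotient sN g0 hg bT kT k0 d0 dk.
apply: (@subquotient_of_coords (dim V) d phi W A a) => //.
by move=> x y /(can_inj r2vK) /(can_inj (mulmxK uB)).
Qed.

End Subquotient.

Theorem corollary2 (R : realType) :
  exists2 C : R, 0 < C &
    forall n : nat, (2 <= n)%N ->
    forall (V : vectType R) (K : set V), \dim {:V} = n -> is_banach_ball K ->
    exists (W : {vspace V}) (U : {vspace (quotv W)}),
      is_round 256 (subquotient U K) /\
      C * n%:R / ln (n%:R : R) <= (\dim U)%:R.
Proof.
have [B0 B0E B01] : exists2 B0 : R, 259 * 2 ^+ 20 = B0 & 1 <= B0.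
  exists (259 * 2 ^+ 20) => //.
  by rewrite mulr_ege1 ?exprn_ege1 ?ler1n.
have B00 : 0 < B0 by apply: lt_le_trans B01.
have ln2 : 0 < ln 2 :> R by rewrite ln_gt0// ltr1n.
exists (ln 2 / (12 * B0)); first by rewrite divr_gt0// mulr_gt0.
move=> n n2 V K dimV ballK.
have dimVn : dim V = n by rewrite -dimV dimvf.
have n0 : (0 < n)%N by apply: leq_trans n2.
have lnn : ln 2 <= ln (n%:R : R) by rewrite ler_ln ?posrE ?ltr0n// ler_nat.
have lnn0 : 0 < ln (n%:R : R) by apply: lt_le_trans lnn.
(* T steps suffice to pass from the ratio 2n of [position] below 1. *)
pose t := trunc_log 2 n; pose T := t.+2.
have tn : (2 ^ t <= n)%N by apply: trunc_logP.
have nt : (n < 2 ^ t.+1)%N by apply: trunc_log_ltn.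
have nT : (2 * n < 2 ^ T)%N by rewrite expnS ltn_pmul2l.
pose k := (n.-1 %/ T)%N.
have kT : (k * T < n)%N by apply: leq_ltn_trans (leq_trunc_div _ _) _; rewrite prednK.
have nk : (n <= k.+1 * T)%N.
  by rewrite -[n in X in (X <= _)%N]prednK// ltn_ceil.
have Tn : T%:R * ln 2 <= 3 * ln (n%:R : R).
  have : t%:R * ln 2 <= ln (n%:R : R).
    rewrite mulr_natl -lnXn// ler_ln ?posrE ?ltr0n ?exprn_gt0//.
    by rewrite -natrX ler_nat.
  by rewrite /T -(addn2 t) natrD mulrDl; lra.
suff [d [d1 nd [W [U [rU dU]]]]] : exists d : nat, [/\ (0 < d)%N,
    n%:R <= 4 * B0 * T%:R * d%:R &
    exists (W : {vspace V}) (U : {vspace quotv W}),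
      is_round 256 (subquotient U K) /\ \dim U = d].
  exists W, U; split; first exact: rU.
  rewrite dU ler_pdivrMr// mulrAC ler_pdivrMr ?mulr_gt0//.
  have h : n%:R * ln 2 <= 4 * B0 * d%:R * (T%:R * ln 2).
    by rewrite [leRHS]mulrA; apply: ler_wpM2r; [exact: ltW | rewrite [leRHS]mulrAC].
  have h2 : 4 * B0 * d%:R * (T%:R * ln 2) <= 4 * B0 * d%:R * (3 * ln (n%:R : R)).
    by apply: ler_wpM2l => //; rewrite !mulr_ge0// ltW.
  by rewrite mulrC; apply: le_trans h _; apply: le_trans h2 _; apply: le_of_eq; ring.
have nkR : n%:R <= (k%:R + 1) * T%:R :> R by rewrite natr1 -natrM ler_nat.
have T0 : 0 < T%:R :> R by rewrite ltr0n.
pose d := Num.truncn (k%:R / B0).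
have kB0 : 0 <= k%:R / B0 by rewrite divr_ge0// ltW.
have /andP[dl du] := truncn_itv kB0.
rewrite -/d in dl du; rewrite ler_pdivlMr// in dl; rewrite ltr_pdivrMr// -natr1 in du.
(* If d = 0 then k < B0, so n / T is bounded and a line is enough. *)
have [d0|d0] := posnP d.
  exists 1%N; split => //; last by apply: (subquotient_line ballK); rewrite dimVn.
  apply: le_trans nkR _; rewrite mulr1; apply: ler_wpM2r; first exact: ltW.
  by move: du; rewrite d0 add0r mul1r; lra.
exists d; split => //.
  apply: le_trans nkR _; rewrite mulrAC; apply: ler_wpM2r; first exact: ltW.
  have d1 : 1 <= d%:R :> R by rewrite ler1n.
  have : B0 <= d%:R * B0 by rewrite ler_peMl// ltW.
  by move: du; rewrite mulrDl mul1r; lra.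
have k0 : (0 < k)%N.
  rewrite -(ltr0n R); apply: lt_le_trans dl; by rewrite mulr_gt0// ltr0n.
apply: (@subquotient_params R V K ballK T k d) => //; rewrite ?dimVn//.
by rewrite B0E mulrC.
Qed.
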